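(* Let $1\le p<\infty$, let $\Omega\subsetneq X$ be an open set and let $w$ be a semilocally doubling weight for $\Omega$. Then a pointwise $(p,w)$-Hardy inequality holds in $\Omega$ if, and only if, $w$ is a $p$-Hardy weight for $\Omega$.
   Context: Standing assumptions. $X=(X,d,\mu)$, with at least two points, is a metric measure space with a metric $d$ and a positive complete Borel regular measure $\mu$ such that, for some constant $D>1$, $0<\mu(B)<\infty$ and $\mu(2B)\le D\mu(B)$ for all balls $B=B(x,r)=\{y\in X: d(y,x)<r\}$, where $\lambda B=B(x,\lambda r)$. A curve is a rectifiable continuous map $\gamma:[a,b]\to X$, with length $\operatorname{len}(\gamma)$; it connects $x$ to $y$ (or to a set $E$) if $\gamma(a)=x$ and $\gamma(b)=y$ (respectively $\gamma(b)\in E$). $X$ is $C_{\mathrm{QC}}$-quasiconvex for a fixed $C_{\mathrm{QC}}\ge1$: all $x,y\in X$ are connected by a curve of length at most $C_{\mathrm{QC}}d(x,y)$. Open sets $\Omega$ are nonempty, $\Omega^c=X\setminus\Omega$, and $d(x,\Omega^c)=\inf_{y\in\Omega^c}d(x,y)$. Notation. For $\nu\ge 1$, $\Gamma(X)^\nu_{x,E}$ is the set of all curves connecting $x$ to the set $E$ with length at most $\nu d(x,E)$. $LC(X)$ is the set of lower semicontinuous real-valued functions on $X$. A Borel function $g\ge0$ is an upper gradient of $u:X\to\mathbb R$ if $|u(\gamma(a))-u(\gamma(b))|\le\int_\gamma g\,ds$ for all curves $\gamma:[a,b]\to X$. $\operatorname{Lip}_0(\Omega)$ is the space of Lipschitz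 functions $u:X\to\mathbb R$ that vanish on $\Omega^c$. Weights. A weight for $\Omega$ is a non-negative Borel function $w$ on $X$ with $\int_B w\,d\mu<\infty$ for all balls $B\subset X$ and $w(x)>0$ for almost every $x\in\Omega$; $w(E)=\int_E w\,d\mu$. For $\Omega\subsetneq X$, $w$ is semilocally doubling for $\Omega$ if for every $\kappa>0$ there is a constant $D(w,\kappa)\ge1$ such that $0<w(B(x,r))\le D(w,\kappa)\,w(B(x,r/2))<\infty$ for all $x\in\Omega$ and $0<r\le\kappa d(x,\Omega^c)$. Maximal function. For $1\le p<\infty$, $0<\kappa<\infty$, $f$ measurable and $x\in\Omega$, $\mathcal M_{p,w,\kappa}f(x)=\sup_{0<r<\kappa d(x,\Omega^c)}\big(\frac1{w(B(x,r))}\int_{B(x,r)}|f|^pw\,d\mu\big)^{1/p}$. $p$-Hardy weight. A weight $w$ for $\Omega\subsetneq X$ is a $p$-Hardy weight for $\Omega$ if there are constants $C_\Gamma>0$, $\nu>C_{\mathrm{QC}}$ and $\kappa>1$ such that for each non-negative bounded $g\in LC(X)$ and every $x\in\Omega$, $$\inf_{\gamma\in\Gamma(X)^\nu_{x,\Omega^c}}\int_\gamma g\,ds\le C_\Gamma\,d(x,\Omega^c)\,\mathcal M_{p,w,\kappa}g(x).$$ Pointwise Hardy inequality. A pointwise $(p,w)$-Hardy inequality holds in $\Omega$ if there are constants $C_{\mathrm H}>0$ and $\kappa>1$ such that for every $u\in\operatorname{Lip}_0(\Omega)$, every bounded upper gradient $g$ of $u$ and every $x\in\Omega$, $|u(x)|\le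 C_{\mathrm H}\,d(x,\Omega^c)\,\mathcal M_{p,w,\kappa}g(x)$. *)

(* Defs.v *)
From HB Require Import structures.
From mathcomp Require Import all_boot all_order all_algebra.
From mathcomp Require Import all_classical all_reals all_analysis.
From mathcomp Require Import measurable_realfun.

Set Implicit Arguments.
Unset Strict Implicit.
Unset Printing Implicit Defensive.

Import Order.TTheory GRing.Theory Num.Theory.
Import numFieldNormedType.Exports.

Local Open Scope classical_set_scope.
Local Open Scope ring_scope.

(* A metric space together with a sigma-algebra; that the latter contains the
   Borel sets is part of [metric_measure_space] below. *)
#[short(type="metricMeasurableType")]
HB.structure Definition MetricMeasurable (d : measure_display)
    (R : numDomainType) :=
  { X of Metric R X & Measurable d X }.

Section Space.
Context {d : measure_display} {R : realType} {X : metricMeasurableType d R}.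
Implicit Types (mu : {measure set X -> \bar R}) (A B E Omega : set X).

Definition borel_set : set (set X) := <<s @open X >>.

(* Non-negative Borel functions (weights, upper gradients) may take the value
   +oo; real-valued functions are embedded by [EFin]. *)
Definition borel_fun (f : X -> \bar R) : Prop :=
  measurable_fun setT (f : g_sigma_algebraType (@open X) -> \bar R).

Definition borel_regular mu : Prop :=
  borel_set `<=` (measurable : set (set X)) /\
  forall A, measurable A ->
    exists B, [/\ borel_set B, A `<=` B & mu B = mu A].

Definition doubling mu : Prop :=
  exists2 D : R, 1 < D &
    forall (x : X) (r : R), 0 < r ->
      [/\ (0 < mu (ball x r))%E, (mu (ball x r) < +oo)%E &
          (mu (ball x (2 * r)) <= D%:E * mu (ball x r))%E].

Definition metric_measure_space mu : Prop :=
  [/\ exists x y : X, x <> y,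
      measure_is_complete mu, borel_regular mu & doubling mu].

Definition dist_to E (x : X) : R := inf [set mdist x y | y in E].

(* Metric counterparts of [variation] and [total_variation]. *)
Definition path_variation (a b : R) (gamma : R -> X) (s : seq R) : R :=
  let F := gamma \o nth b (a :: s) in
  \sum_(0 <= n < size s) mdist (F n) (F n.+1).

Definition path_length (a b : R) (gamma : R -> X) : \bar R :=
  ereal_sup [set (path_variation a b gamma s)%:E | s in itv_partition a b].

(* Only the values of [cmap] on [[cstart, cend]] are meaningful. *)
Record curve := Curve {
  cstart : R ;
  cend : R ;
  cmap :> R -> X ;
  _ : cstart <= cend ;
  _ : {within `[cstart, cend], continuous cmap} ;
  _ : (path_length cstart cend cmap < +oo)%E }.

Definition len (gamma : curve) : \bar R :=
  path_length (cstart gamma) (cend gamma) gamma.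

(* For [0 <= s <= len gamma], the common value of [gamma] at the parameters [t]
   for which the restriction of [gamma] to [[cstart, t]] has length [s]. *)
Definition arclength_param (gamma : curve) (s : R) : X :=
  xget point [set gamma t | t in
    [set t | cstart gamma <= t <= cend gamma /\
             path_length (cstart gamma) t gamma = s%:E]].

Definition curve_integral (g : X -> \bar R) (gamma : curve) : \bar R :=
  (\int[lebesgue_measure]_(s in `[0%R, fine (len gamma)])
     g (arclength_param gamma s))%E.

Definition quasiconvex (C : R) : Prop :=
  forall x y : X, exists gamma : curve,
    [/\ gamma (cstart gamma) = x, gamma (cend gamma) = y &
        (len gamma <= (C * mdist x y)%:E)%E].

Definition Gamma (nu : R) (x : X) E : set curve :=
  [set gamma : curve | [/\ gamma (cstart gamma) = x, E (gamma (cend gamma)) &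
                           (len gamma <= (nu * dist_to E x)%:E)%E]].

Definition upper_gradient (u : X -> R) (g : X -> \bar R) : Prop :=
  [/\ borel_fun g, forall x, (0 <= g x)%E &
      forall gamma : curve,
        (`|u (gamma (cstart gamma)) - u (gamma (cend gamma))|%:E
         <= curve_integral g gamma)%E].

Definition Lip0 Omega : set (X -> R) :=
  [set u | (exists L : R, forall x y, `|u x - u y| <= L * mdist x y) /\
           (forall x, ~ Omega x -> u x = 0)].

Definition wmeasure mu (w : X -> \bar R) E : \bar R :=
  (\int[mu]_(y in E) w y)%E.

Definition weight mu Omega (w : X -> \bar R) : Prop :=
  [/\ borel_fun w, forall x, (0 <= w x)%E,
      forall (x : X) (r : R), 0 < r -> (wmeasure mu w (ball x r) < +oo)%E &
      {ae mu, forall x, Omega x -> (0 < w x)%E}].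

Definition semilocally_doubling mu Omega (w : X -> \bar R) : Prop :=
  forall kappa : R, 0 < kappa ->
    exists2 D : R, 1 <= D &
      forall (x : X) (r : R), Omega x ->
        0 < r <= kappa * dist_to (~` Omega) x ->
        [/\ (0 < wmeasure mu w (ball x r))%E,
            (wmeasure mu w (ball x r)
             <= D%:E * wmeasure mu w (ball x (r / 2)))%E &
            (D%:E * wmeasure mu w (ball x (r / 2)) < +oo)%E].

Definition maximal mu Omega (p : R) (w : X -> \bar R) (kappa : R)
    (f : X -> \bar R) (x : X) : \bar R :=
  ereal_sup [set
    (((wmeasure mu w (ball x r))^-1
      * \int[mu]_(y in ball x r) (`|f y| `^ p * w y)) `^ p^-1)%E |
    r in [set r : R | 0 < r < kappa * dist_to (~` Omega) x]].

Definition hardy_weight mu (CQC : R) Omega (p : R) (w : X -> \bar R) : Prop :=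
  weight mu Omega w /\
  exists CG nu kappa : R,
    [/\ 0 < CG, CQC < nu, 1 < kappa &
        forall g : X -> R,
          (forall x, 0 <= g x) -> (exists M, forall x, g x <= M) ->
          lower_semicontinuous (EFin \o g) ->
          forall x, Omega x ->
            (ereal_inf [set curve_integral (EFin \o g) gamma |
                        gamma in Gamma nu x (~` Omega)]
             <= (CG * dist_to (~` Omega) x)%:E
                * maximal mu Omega p w kappa (EFin \o g) x)%E].

Definition pointwise_hardy mu Omega (p : R) (w : X -> \bar R) : Prop :=
  exists CH kappa : R,
    [/\ 0 < CH, 1 < kappa &
        forall (u : X -> R) (g : X -> \bar R),
          Lip0 Omega u -> upper_gradient u g ->
          (exists M : R, forall x, (g x <= M%:E)%E) ->
          forall x, Omega x ->
            (`|u x|%:E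
             <= (CH * dist_to (~` Omega) x)%:E
                * maximal mu Omega p w kappa g x)%E].

End Space.

Arguments curve {d R} X.
Arguments quasiconvex {d R} X C.

(* Main.v *)
From HB Require Import structures.
Require Import Defs.
From mathcomp Require Import all_boot all_order all_algebra.
From mathcomp Require Import all_classical all_reals all_analysis.
From mathcomp Require Import measurable_realfun lra ring.

Set Implicit Arguments.
Unset Strict Implicit.
Unset Printing Implicit Defensive.

Import Order.TTheory GRing.Theory Num.Theory.
Import numFieldNormedType.Exports.

Local Open Scope classical_set_scope.
Local Open Scope ring_scope.

(** Fix a point [x] of [Omega]; write [D] for its distance to the complement of
    [Omega] and [M] for the maximal function.

    From the pointwise inequality to the Hardy weight
    ([hardy_weight_of_pointwise]): given [g] and [a > M g x], add the constant
    [a] to [g] and let [u y] be the infimum of the integrals of [g + a] over the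
    curves from [y] to the complement of [Omega].  Gluing and reversing curves
    shows that [g + a] is an upper gradient of [u], quasiconvexity makes [u]
    Lipschitz, and constant curves make it vanish off [Omega]
    ([curve_inf_upper_gradient], [curve_inf_Lip0]).  As [M (g + a) x <= 4 a]
    ([maximal_add_cst]), the hypothesis bounds [u x] by a multiple of [D a], so
    some curve from [x] has [g + a]-integral at most [C D a].  Its [g]-integral
    is then at most [C D a], and its length, being at most the integral divided
    by [a], is at most [C D]: the constant [a] is what controls the length.

    From the Hardy weight to the pointwise inequality
    ([pointwise_of_hardy_weight]): an upper gradient [g] need not be lower
    semicontinuous, so it is replaced by a lower semicontinuous majorant [h].
    The maximal function is a supremum over arbitrarily small balls centred at
    [x], hence the error of the approximation has to be small relative to all
    of these balls at once.  This is possible at the cost of the value at [x]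
    itself ([lsc_majorant_off_point], which rests on outer regularity over the
    annuli around [x], [borel_outer_regular_at]).  The lost value is harmless:
    a curve from [x] can be cut at its last visit of [x] ([tail_curve]), and on
    the remaining part [h] dominates [g], so that [|u x|] is at most the
    integral of [h] over the whole curve.

    Both arguments need a calculus of curve integrals.  Its base is that length
    is additive and depends continuously on the endpoint
    ([path_lengthD], [path_length_continuous]); hence the arc-length
    parametrization is a 1-Lipschitz map on the whole interval from [0] to the
    length, and integrals split over subcurves ([curve_integral_split]). *)

(** * Length of paths in a metric space *)

Section PathLength.
Context {d : measure_display} {R : realType} {X : metricMeasurableType d R}.
Implicit Types (f g : R -> X) (a b c t : R).

Lemma path_variation_nil a b f : path_variation a b f [::] = 0.
Proof. by rewrite /path_variation big_nil. Qed.

Lemma path_variation_cons a b f x s :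
  path_variation a b f (x :: s)
    = mdist (f a) (f x) + path_variation x b f s.
Proof. by rewrite /path_variation /= big_nat_recl. Qed.

Lemma path_variation_le_length a b f s : itv_partition a b s ->
  ((path_variation a b f s)%:E <= path_length a b f)%E.
Proof. by move=> abs; apply: ereal_sup_ubound; exists s. Qed.

(** Length is the least superadditive functional that dominates distances.
    Every upper bound on a length below is obtained from this by treating a
    single step of a partition; [W x] stands for the length from [x] to [b]. *)
Lemma path_length_le (W : R -> \bar R) a b f : (0 <= W b)%E ->
  (forall x y, a <= x -> x < y -> y <= b ->
     ((mdist (f x) (f y))%:E + W y <= W x)%E) ->
  (path_length a b f <= W a)%E.
Proof.
move=> Wb WD; apply: ge_ereal_sup => _ [s abs <-].
elim: s a abs WD => [a /itv_partition_nil -> _|x s ih a abs WD].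
  by rewrite path_variation_nil.
have [/= /andP[ax _] _] := abs.
have xbs := itv_partition_cons abs.
have xb := itv_partition_le xbs.
rewrite path_variation_cons EFinD (le_trans _ (WD a x _ _ _))// leeD2l//.
by apply: ih => // y z xy; apply: WD; rewrite (le_trans (ltW ax)).
Qed.

Lemma path_lengthxx a f : path_length a a f = 0%E.
Proof.
apply/eqP; rewrite eq_le; apply/andP; split.
  by apply: (@path_length_le (fun=> 0%E)) => // x y ax xy ya;
    move: (le_lt_trans ax (lt_le_trans xy ya)); rewrite ltxx.
rewrite -[leLHS](_ : (path_variation a a f [::])%:E = _).
  by apply: path_variation_le_length.
by rewrite path_variation_nil.
Qed.

Lemma path_length_ge0 a b f : a <= b -> (0 <= path_length a b f)%E.
Proof.
rewrite le_eqVlt => /predU1P[<-|ab]; first by rewrite path_lengthxx.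
rewrite (le_trans _ (@path_variation_le_length a b f [:: b] _))//.
  by rewrite path_variation_cons path_variation_nil addr0 lee_fin mdist_ge0.
exact: itv_partition1.
Qed.

Lemma mdist_path_length a b c f : a <= b -> b <= c ->
  ((mdist (f a) (f b))%:E + path_length b c f <= path_length a c f)%E.
Proof.
rewrite le_eqVlt => /predU1P[<-|ab] bc; first by rewrite mdistxx add0e.
rewrite -leeBrDl//; apply: ge_ereal_sup => _ [s bcs <-].
rewrite leeBrDl// -EFinD -path_variation_cons.
apply: path_variation_le_length; move: bcs; rewrite /itv_partition/= ab.
by case.
Qed.

Lemma mdist_le_path_length a b f : a <= b ->
  ((mdist (f a) (f b))%:E <= path_length a b f)%E.
Proof.
move=> ab; have := mdist_path_length f ab (lexx b).
by rewrite path_lengthxx adde0.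
Qed.

Lemma path_lengthD a b c f : a <= c -> c <= b ->
  path_length a b f = (path_length a c f + path_length c b f)%E.
Proof.
move=> ac cb; apply/eqP; rewrite eq_le; apply/andP; split.
  pose W x := if x <= c then (path_length x c f + path_length c b f)%E
              else path_length x b f.
  have -> : (path_length a c f + path_length c b f)%E = W a.
    by rewrite /W ac.
  apply: path_length_le => [|x y ax xy yb].
    rewrite /W; case: ifP => bc; last by rewrite path_lengthxx.
    by rewrite adde_ge0// path_length_ge0.
  rewrite /W; case: (leP y c) => yc.
    rewrite (ltW (lt_le_trans xy yc)) addeA leeD2r//.
    exact: mdist_path_length (ltW xy) yc.
  case: (leP x c) => xc; last exact: mdist_path_length (ltW xy) yb.
  apply: (@le_trans _ _ ((mdist (f x) (f c))%:E
                         + ((mdist (f c) (f y))%:E + path_length y b f))%E).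
    by rewrite addeA -EFinD leeD2r// lee_fin metric_triangle.
  by rewrite leeD ?mdist_le_path_length// mdist_path_length// ltW.
have [cby|cbfin] := eqVneq (path_length c b f) +oo%E.
  have := mdist_path_length f ac cb.
  by rewrite cby addey// leye_eq => /eqP ->; rewrite leey.
have {}cbfin : path_length c b f \is a fin_num.
  by rewrite ge0_fin_numE ?path_length_ge0// ltey.
rewrite -leeBrDr//.
apply: (@path_length_le (fun x => path_length x b f - path_length c b f)%E).
  by rewrite subee.
move=> x y ax xy yc; rewrite addeA leeD2r// mdist_path_length ?(ltW xy)//.
exact: le_trans yc cb.
Qed.

Lemma eq_path_length a b f g : (forall t, a <= t <= b -> f t = g t) ->
  path_length a b f = path_length a b g.
Proof.
suff H f' g' : (forall t, a <= t <= b -> f' t = g' t) ->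
    (path_length a b f' <= path_length a b g')%E.
  by move=> fg; apply/eqP; rewrite eq_le !H// => t /fg.
move=> fg; apply: (@path_length_le (fun x => path_length x b g')).
  by rewrite path_lengthxx.
move=> x y ax xy yb; rewrite !fg ?mdist_path_length ?(ltW xy)//.
- by rewrite yb (le_trans ax)// ltW.
- by rewrite ax/= (le_trans _ yb)// ltW.
Qed.

Lemma path_length_shift a b c f :
  path_length a b (fun t => f (t + c)) = path_length (a + c) (b + c) f.
Proof.
suff H a' b' c' f' : (path_length a' b' (fun t => f' (t + c')%R)
    <= path_length (a' + c')%R (b' + c')%R f')%E.
  apply/eqP; rewrite eq_le H/=.
  have := H (a + c) (b + c) (- c) (fun t => f (t + c)).
  rewrite !addrK; apply: le_trans.
  by rewrite le_eqVlt (_ : (fun t => _) = f) ?eqxx//; apply/funext=> t; rewrite subrK.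
apply: (@path_length_le (fun x => path_length (x + c') (b' + c') f')).
  by rewrite path_lengthxx.
by move=> x y ax xy yb; rewrite mdist_path_length// lerD2r// ltW.
Qed.

Lemma path_length_opp a b f : a <= b ->
  path_length a b (fun t => f (- t)) = path_length (- b) (- a) f.
Proof.
suff H a' b' f' : a' <= b' -> (path_length a' b' (fun t => f' (- t)%R)
    <= path_length (- b')%R (- a')%R f')%E.
  move=> ab; apply/eqP; rewrite eq_le H//=.
  have := H (- b) (- a) (fun t => f (- t)); rewrite lerN2 !opprK => /(_ ab).
  apply: le_trans.
  by rewrite le_eqVlt (_ : (fun t => _) = f) ?eqxx//; apply/funext=> t; rewrite opprK.
move=> ab.
apply: (@path_length_le (fun x => path_length (- b') (- x) f')).
  by rewrite path_lengthxx.
move=> x y ax xy yb; rewrite (@path_lengthD (- b') (- x) (- y)) ?lerN2 ?(ltW xy)//.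
by rewrite addeC leeD2l// metric_sym mdist_le_path_length// lerN2 ltW.
Qed.

(** A near-optimal partition remains near-optimal when a point close to [a] is
    inserted; the part of the length before that point is then small. *)
Lemma path_length_small_right a b f (e : R) : a < b ->
  (path_length a b f < +oo)%E -> 0 < e ->
  (forall r : R, 0 < r -> exists2 t0 : R, 0 < t0 &
     forall t, a < t -> t <= b -> t < a + t0 -> mdist (f a) (f t) < r) ->
  exists2 t0 : R, 0 < t0 &
    forall t, a < t -> t <= b -> t < a + t0 -> (path_length a t f < e%:E)%E.
Proof.
move=> ab abfin e0 cf.
have e20 : 0 < e / 2 by rewrite divr_gt0.
have abf : path_length a b f \is a fin_num.
  by rewrite ge0_fin_numE ?path_length_ge0// ltW.
have [_ [s abs <-] sub] := ub_ereal_sup_adherent e20 abf.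
case: s abs sub => [/itv_partition_nil ab'|x s abs sub].
  by move: ab; rewrite ab' ltxx.
have [/= /andP[ax _] _] := abs.
have xbs := itv_partition_cons abs.
have xb := itv_partition_le xbs.
have [t0 t00 t0P] := cf _ e20.
exists (Num.min t0 (x - a)); first by rewrite lt_min t00 subr_gt0.
move=> t at_ tb; rewrite -ltrBlDl lt_min => /andP[tt0].
rewrite ltrD2r => tx.
have tbs : itv_partition t b (x :: s).
  by move: abs; rewrite /itv_partition/= tx ax.
have tbf : path_length t b f \is a fin_num.
  rewrite ge0_fin_numE ?path_length_ge0//.
  apply: le_lt_trans abfin; rewrite (@path_lengthD a b t)// ?(ltW at_)//.
  by rewrite leeDr// path_length_ge0// ltW.
move: sub; rewrite -/(path_length a b f).
rewrite (@path_lengthD a b t)// ?(ltW at_)// => sub.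
rewrite -(lteD2rE _ _ tbf).
move: sub; rewrite lteBlDr// => /lt_le_trans; apply.
apply: (@le_trans _ _ ((mdist (f a) (f t))%:E
    + (path_variation t b f (x :: s))%:E + (e / 2)%:E)%E).
  rewrite -!EFinD lee_fin lerD2r// !path_variation_cons addrA lerD2r.
  exact: metric_triangle.
rewrite addeAC leeD ?path_variation_le_length//.
rewrite -EFinD lee_fin [leRHS]splitr lerD2r ltW// t0P//.
by rewrite -ltrBlDl.
Qed.

End PathLength.

(** * Arc-length parametrization *)

Section CurveLength.
Context {d : measure_display} {R : realType} {X : metricMeasurableType d R}.
Implicit Types (f g : R -> X) (a b c t : R) (gamma : curve X).

Lemma within_itv_continuousP a b f :
  {within `[a, b], continuous f} <->
  forall t, a <= t <= b -> forall r : R, 0 < r -> exists2 t0 : R, 0 < t0 &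
    forall s, a <= s <= b -> `|s - t| < t0 -> mdist (f t) (f s) < r.
Proof.
rewrite subspace_continuousP; split=> [cf t tab r r0|cf t /= tab].
  have /cf : `[a, b]%classic t by rewrite /= in_itv.
  move=> /metricType_numDomainType.cvgrPdist_lt/(_ _ r0) [t0 /= t00 H].
  exists t0 => // s sab st; apply: H; last by rewrite /= in_itv.
  by rewrite /= distrC.
apply/metricType_numDomainType.cvgrPdist_lt => r r0.
have [t0 t00 H] := cf t (ltac:(by move: tab; rewrite in_itv)) r r0.
exists t0 => //= s st; rewrite in_itv/= /from_subspace => sab.
by apply: H => //; rewrite distrC.
Qed.

Lemma curve_le gamma : cstart gamma <= cend gamma.
Proof. by case: gamma. Qed.

Lemma curve_continuous gamma :
  {within `[cstart gamma, cend gamma], continuous gamma}.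
Proof. by case: gamma. Qed.

Lemma len_fin_num gamma : len gamma \is a fin_num.
Proof.
by rewrite ge0_fin_numE ?path_length_ge0 ?curve_le//; case: gamma.
Qed.

Lemma path_length_fin_num gamma s t :
  cstart gamma <= s -> s <= t -> t <= cend gamma ->
  path_length s t gamma \is a fin_num.
Proof.
move=> as_ st tb; rewrite ge0_fin_numE ?path_length_ge0//.
have : (len gamma < +oo)%E by rewrite ltey_eq len_fin_num.
apply: le_lt_trans.
rewrite /len (@path_lengthD _ _ _ (cstart gamma) (cend gamma) s)// ?(le_trans st)//.
rewrite (@path_lengthD _ _ _ s (cend gamma) t)//.
by rewrite (@le_trans _ _ (path_length s t gamma + path_length t (cend gamma) gamma)%E)//
  ?leeDl ?leeDr// path_length_ge0.
Qed.

(** The lengths of the pieces next to a point tend to zero from the right, hence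
    also from the left, since reversing the path exchanges the two sides. *)
Lemma path_length_continuous gamma :
  {within `[cstart gamma, cend gamma],
    continuous (fun t => fine (path_length (cstart gamma) t gamma))}.
Proof.
set a := cstart gamma; set b := cend gamma.
have /within_itv_continuousP cg := @curve_continuous gamma.
have pfin s t : a <= s -> s <= t -> t <= b -> path_length s t gamma \is a fin_num.
  exact: path_length_fin_num.
have small t (r : R) : a <= t <= b -> 0 < r -> exists2 t0 : R, 0 < t0 &
    forall s, a <= s <= b -> `|s - t| < t0 ->
      (path_length (Num.min s t) (Num.max s t) gamma < r%:E)%E.
  move=> /andP[at_ tb] r0.
  have [u u0 uP] : exists2 t0 : R, 0 < t0 &
      forall s, t < s -> s <= b -> s < t + t0 ->
      (path_length t s gamma < r%:E)%E.
    have [tb'|] := ltP t b; last first.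
      move=> bt; exists 1 => // s ts sb.
      by move: (lt_le_trans ts (le_trans sb bt)); rewrite ltxx.
    apply: path_length_small_right tb' _ r0 _.
      by rewrite ltey_eq pfin.
    move=> e e0; have [t0 t00 H] := cg t (ltac:(by rewrite at_)) e e0.
    exists t0 => // s ts sb st; apply: H.
      by rewrite sb (le_trans at_)// ltW.
    by rewrite ger0_norm ?subr_ge0 ?ltW// ltrBlDl.
  have [v v0 vP] : exists2 t0 : R, 0 < t0 &
      forall s, s < t -> a <= s -> t < s + t0 ->
      (path_length s t gamma < r%:E)%E.
    have [at'|] := ltP a t; last first.
      move=> ta; exists 1 => // s st as_.
      by move: (lt_le_trans st (le_trans ta as_)); rewrite ltxx.
    have := @path_length_small_right _ _ _ (- t) (- a)
      (fun s => gamma (- s)) r.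
    rewrite ltrN2 path_length_opp ?lerN2 ?ltW// !opprK => /(_ at').
    rewrite ltey_eq pfin// => /(_ isT r0)[].
      move=> e e0; have [t0 t00 H] := cg t (ltac:(by rewrite at_)) e e0.
      exists t0 => // s ts sb st; apply: H.
        by rewrite lerNr sb/= (le_trans _ tb)// lerNl ltW.
      by rewrite ltr0_norm ?subr_lt0 1?ltrNl//; move: st; lra.
    move=> t0 t00 H; exists t0 => // s st as_ ts.
    have := H (- s); rewrite ltrN2 lerN2 => /(_ st as_).
    rewrite path_length_opp ?lerN2 ?(ltW st)// !opprK; apply.
    by move: ts; lra.
  exists (Num.min u v); first by rewrite lt_min u0.
  move=> s /andP[as_ sb]; rewrite lt_min => /andP[su sv].
  case: (ltgtP s t) => st.
  - by apply: vP => //; move: sv; rewrite ltr0_norm ?subr_lt0//; lra.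
  - by apply: uP => //; move: su; rewrite gtr0_norm ?subr_gt0//; lra.
  - by rewrite path_lengthxx lte_fin.
apply/subspace_continuousP => t /=; rewrite in_itv/= => tab.
apply/cvgrPdist_lt => r r0.
have [t0 t00 H] := small t r tab r0.
exists t0 => //= s st; rewrite in_itv/= /from_subspace => sab.
have := H s sab; rewrite distrC => /(_ st).
have /andP[at_ tb] := tab; have /andP[as_ sb] := sab.
case: (ltgtP s t) => [s_t|t_s|->] P; last by rewrite subrr normr0.
- rewrite (@path_lengthD _ _ _ a t s)// ?(ltW s_t)//.
  rewrite fineD ?pfin ?(ltW s_t)// addrC addrA addNr add0r.
  rewrite ger0_norm ?fine_ge0 ?path_length_ge0 ?(ltW s_t)//.
  by rewrite -lte_fin fineK// pfin// ltW.
- rewrite (@path_lengthD _ _ _ a s t)// ?(ltW t_s)//.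
  rewrite fineD ?pfin ?(ltW t_s)// opprD addrA subrr add0r normrN.
  rewrite ger0_norm ?fine_ge0 ?path_length_ge0 ?(ltW t_s)//.
  by rewrite -lte_fin fineK// pfin// ltW.
Qed.

(** By the intermediate value theorem the arc-length parametrization has no gaps. *)
Lemma path_length_surj gamma s : 0 <= s <= fine (len gamma) ->
  exists2 t, cstart gamma <= t <= cend gamma &
    path_length (cstart gamma) t gamma = s%:E.
Proof.
move=> /andP[s0 sL].
have := @IVT _ (fun t => fine (path_length (cstart gamma) t gamma)) _ _ s
  (curve_le gamma) (@path_length_continuous gamma).
have L0 : 0 <= fine (len gamma) by rewrite fine_ge0// path_length_ge0// curve_le.
rewrite path_lengthxx/= -/(len gamma) (min_idPl L0) (max_idPr L0) s0 sL.
move=> /(_ isT)[t].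
rewrite in_itv/= => tab <-; exists t => //.
by have /andP[? ?] := tab; rewrite fineK// path_length_fin_num.
Qed.

(** Hence two parameters of the same arc length give the same point, so that
    the choice made by [arclength_param] does not matter. *)
Lemma mdist_curve_le gamma s t r r' :
  cstart gamma <= s <= cend gamma -> cstart gamma <= t <= cend gamma ->
  path_length (cstart gamma) s gamma = r%:E ->
  path_length (cstart gamma) t gamma = r'%:E ->
  mdist (gamma s) (gamma t) <= `|r - r'|.
Proof.
wlog st : s t r r' / s <= t.
  move=> H; case: (leP s t) => [|/ltW]; first exact: H.
  by rewrite metric_sym distrC => ? ? ? ? ?; exact: H.
move=> /andP[as_ sb] /andP[at_ tb] sr.
rewrite (@path_lengthD _ _ _ _ t s)// sr => tr'.
have := mdist_le_path_length gamma st.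
rewrite -(@leeD2lE _ r%:E)// tr' -EFinD lee_fin -lerBrDl distrC => /le_trans.
by apply; exact: ler_norm.
Qed.

Lemma arclength_paramE gamma t s :
  cstart gamma <= t <= cend gamma ->
  path_length (cstart gamma) t gamma = s%:E -> arclength_param gamma s = gamma t.
Proof.
move=> tab ts; rewrite /arclength_param; case: xgetP => [x -> [u [uab us] <-]|].
  apply: mdist_positivity; apply/eqP; rewrite eq_le mdist_ge0 andbT.
  by have := mdist_curve_le uab tab us ts; rewrite subrr normr0.
by move=> /(_ (gamma t))/= H; exfalso; apply: H; exists t.
Qed.

Lemma arclength_param_lipschitz gamma s s' :
  0 <= s <= fine (len gamma) -> 0 <= s' <= fine (len gamma) ->
  mdist (arclength_param gamma s) (arclength_param gamma s') <= `|s - s'|.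
Proof.
move=> /path_length_surj[t tab ts] /path_length_surj[t' tab' ts'].
by rewrite (arclength_paramE tab ts) (arclength_paramE tab' ts') mdist_curve_le.
Qed.

Lemma measurable_arclength_param gamma (h : X -> \bar R) : borel_fun h ->
  measurable_fun `[0%R, fine (len gamma)] (h \o arclength_param gamma).
Proof.
pose Xb := g_sigma_algebraType (@open X).
move=> mh; suff mg : measurable_fun `[0%R, fine (len gamma)]
    (arclength_param gamma : _ -> Xb).
  exact: (@measurableT_comp _ _ _ _ Xb _ h).
apply: (@measurability _ _ _ Xb _ _ (@open X) erefl) => _ [U oU <-].
apply: open_measurable_subspace => //.
have /continuousP : {within `[0%R, fine (len gamma)],
    continuous (arclength_param gamma)}.
  apply/within_itv_continuousP => s sI r r0; exists r => // s' s'I.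
  by rewrite distrC; apply: le_lt_trans; exact: arclength_param_lipschitz.
exact.
Qed.

End CurveLength.

(** * Isometries of the line and Lebesgue integrals *)

Section LebesgueInvariance.
Context {R : realType}.
Local Notation leb := (@lebesgue_measure R).

Lemma lebesgue_measure_shift (c : R) (A : set R) : measurable A ->
  pushforward leb ((fun s => c + s) : _ -> measurableTypeR R) A = leb A.
Proof.
move=> mA; apply/esym/lebesgue_measure_unique => //= [|mphi _ [[a b]] _ <-].
  exact: measurable_funD.
rewrite /pushforward/= (_ : _ @^-1` _ = `]a - c, b - c]%classic); last first.
  by apply/seteqP; split => s /=; rewrite !in_itv/= ltrBlDl lerBrDl.
rewrite !lebesgue_measure_itv/= !lte_fin ltrD2r; case: ifP => // _.
by rewrite -!EFinB; congr EFin; lra.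
Qed.

Lemma lebesgue_measure_reflect (c : R) (A : set R) : measurable A ->
  pushforward leb ((fun s => c - s) : _ -> measurableTypeR R) A = leb A.
Proof.
move=> mA; apply/esym/lebesgue_measure_unique => //= [|mphi _ [[a b]] _ <-].
  exact: measurable_funB.
rewrite /pushforward/= (_ : _ @^-1` _ = `[c - b, c - a[%classic); last first.
  by apply/seteqP; split => s /=; rewrite !in_itv/= lerBlDr ltrBrDr
    -lerBlDl -ltrBrDl => /andP[sa sb]; apply/andP; split; lra.
rewrite !lebesgue_measure_itv/= !lte_fin ltrD2l ltrN2; case: ifP => // _.
by rewrite -!EFinB; congr EFin; lra.
Qed.

Lemma ge0_integral_lebesgue_invariant (phi : measurableTypeR R -> measurableTypeR R)
    (D : set (measurableTypeR R)) (f : measurableTypeR R -> \bar R) : measurable_fun setT phi ->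
  (forall A, measurable A -> pushforward leb phi A = leb A) ->
  measurable D -> measurable_fun D f -> (forall s, D s -> (0 <= f s)%E) ->
  (\int[leb]_(s in phi @^-1` D) f (phi s) = \int[leb]_(s in D) f s)%E.
Proof.
move=> mphi phiE mD mf f0.
have f0' : {in D, forall s, 0 <= f s}%E by move=> s; rewrite inE; exact: f0.
rewrite -[LHS](ge0_integral_pushforward mphi _ mD mf f0').
by apply: eq_measure_integral => //= A mA AS; exact: phiE.
Qed.

Lemma ge0_integral_shift (c l : R) (f : R -> \bar R) :
  measurable_fun `[c, c + l] f -> (forall s, c <= s <= c + l -> (0 <= f s)%E) ->
  (\int[leb]_(s in `[0%R, l]) f (c + s)%R = \int[leb]_(s in `[c, (c + l)%R]) f s)%E.
Proof.
move=> mf f0.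
rewrite -[RHS](@ge0_integral_lebesgue_invariant (fun s => c + s))//.
- rewrite (_ : _ @^-1` _ = `[0, l]%classic)//; apply/seteqP.
  by split => s /=; rewrite !in_itv/= lerD2l lerDl.
- exact: measurable_funD.
- exact: lebesgue_measure_shift.
Qed.

Lemma ge0_integral_reflect (l : R) (f : R -> \bar R) :
  measurable_fun `[0, l] f -> (forall s, 0 <= s <= l -> (0 <= f s)%E) ->
  (\int[leb]_(s in `[0%R, l]) f (l - s)%R = \int[leb]_(s in `[0%R, l]) f s)%E.
Proof.
move=> mf f0.
rewrite -[RHS](@ge0_integral_lebesgue_invariant (fun s => l - s))//.
- rewrite (_ : _ @^-1` _ = `[0, l]%classic)//; apply/seteqP.
  by split => s /=; rewrite !in_itv/= subr_ge0 gerBl andbC.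
- exact: measurable_funB.
- exact: lebesgue_measure_reflect.
Qed.

End LebesgueInvariance.

(** * Integrals along curves *)

Section CurveIntegral.
Context {d : measure_display} {R : realType} {X : metricMeasurableType d R}.
Implicit Types (gamma : curve X) (h : X -> \bar R).
Local Notation leb := (@lebesgue_measure R).

Lemma curve_integral_lenE gamma h (l : R) : len gamma = l%:E ->
  curve_integral h gamma =
  (\int[leb]_(s in `[0%R, l]) h (arclength_param gamma s))%E.
Proof. by rewrite /curve_integral => ->. Qed.

Lemma len_ge0 gamma : 0 <= fine (len gamma).
Proof. by rewrite fine_ge0// path_length_ge0// curve_le. Qed.

Lemma curve_integral_ge0 gamma h : (forall x, 0 <= h x)%E ->
  (0 <= curve_integral h gamma)%E.
Proof. by move=> h0; apply: integral_ge0. Qed.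

Lemma ge0_le_curve_integral gamma h1 h2 : borel_fun h1 -> borel_fun h2 ->
  (forall x, 0 <= h1 x)%E -> (forall x, h1 x <= h2 x)%E ->
  (curve_integral h1 gamma <= curve_integral h2 gamma)%E.
Proof.
move=> mh1 mh2 h0 h12; apply: ge0_le_integral => //.
- exact: measurable_arclength_param.
- exact: measurable_arclength_param.
Qed.

Lemma curve_integral_cst gamma (c : R) :
  curve_integral (cst c%:E) gamma = (c%:E * len gamma)%E.
Proof.
rewrite /curve_integral integral_cst//= lebesgue_measure_itv/= lte_fin.
rewrite -[in RHS](fineK (len_fin_num gamma)).
case: ltP => [_|L0]; first by rewrite sube0.
by have /eqP -> : fine (len gamma) == 0 by rewrite eq_le L0 len_ge0.
Qed.

Lemma borel_fun_cst (c : \bar R) : borel_fun (cst c : X -> \bar R).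
Proof. exact: measurable_cst. Qed.

Lemma curve_integral_le gamma h (M : R) : borel_fun h ->
  (forall x, 0 <= h x)%E -> (forall x, h x <= M%:E)%E ->
  (curve_integral h gamma <= M%:E * len gamma)%E.
Proof.
move=> mh h0 hM; rewrite -curve_integral_cst.
by apply: ge0_le_curve_integral => //; exact: borel_fun_cst.
Qed.

Lemma curve_integral_ge gamma h (m : R) : borel_fun h -> 0 <= m ->
  (forall x, m%:E <= h x)%E -> (m%:E * len gamma <= curve_integral h gamma)%E.
Proof.
move=> mh m0 hm; rewrite -curve_integral_cst.
by apply: ge0_le_curve_integral => //; exact: borel_fun_cst.
Qed.

Lemma curveP (f : R -> X) (a b : R) : a <= b ->
  {within `[a, b], continuous f} -> (path_length a b f < +oo)%E ->
  exists gamma, [/\ cstart gamma = a, cend gamma = b & cmap gamma = f].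
Proof. by move=> ab cf lf; exists (Curve ab cf lf). Qed.

Lemma subcurveP gamma (s t : R) : cstart gamma <= s -> s <= t ->
  t <= cend gamma ->
  exists gamma', [/\ cstart gamma' = s, cend gamma' = t & cmap gamma' = gamma].
Proof.
move=> as_ st tb; apply: curveP => //.
  apply: continuous_subspaceW (@curve_continuous _ _ _ gamma).
  by move=> u /=; rewrite !in_itv/= => /andP[su ut];
    rewrite (le_trans as_)//= (le_trans ut).
by rewrite ltey_eq path_length_fin_num.
Qed.

(** Up to the end of [gamma1] the arc length of [gamma] is that of [gamma1]; past
    it, it is [len gamma1] plus that of [gamma2].  The integral of [gamma] thus
    splits at [len gamma1], up to a translation of the variable. *)
Section Split.
Variables (gamma gamma1 gamma2 : curve X).
Hypotheses (start1 : cstart gamma1 = cstart gamma)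
  (mid : cend gamma1 = cstart gamma2) (end2 : cend gamma2 = cend gamma)
  (agree1 : forall t, cstart gamma1 <= t <= cend gamma1 -> gamma1 t = gamma t)
  (agree2 : forall t, cstart gamma2 <= t <= cend gamma2 -> gamma2 t = gamma t).

Let l1 := fine (len gamma1).
Let l2 := fine (len gamma2).

Let path_length1 t : cstart gamma1 <= t <= cend gamma1 ->
  path_length (cstart gamma) t gamma = path_length (cstart gamma1) t gamma1.
Proof.
move=> /andP[a1t tb1]; rewrite -start1; apply: eq_path_length => u /andP[au ut].
by rewrite agree1// au (le_trans ut).
Qed.

Let path_length2 t : cstart gamma2 <= t <= cend gamma2 ->
  path_length (cstart gamma) t gamma =
  (l1%:E + path_length (cstart gamma2) t gamma2)%E.
Proof.
move=> /andP[a2t tb2].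
have a1 := curve_le gamma1; have a2 := curve_le gamma2.
rewrite (@path_lengthD _ _ _ _ _ (cend gamma1)) ?mid// -?start1 -?mid//.
rewrite start1 path_length1 ?a1 ?lexx// -/(len gamma1) mid fineK ?len_fin_num//.
congr (_ + _)%E; apply: eq_path_length => u /andP[au ut].
by rewrite agree2// au (le_trans ut).
Qed.

Lemma len_split : len gamma = (l1 + l2)%:E.
Proof.
rewrite /len -end2 path_length2 ?curve_le ?lexx//.
by rewrite EFinD; congr (_ + _)%E; rewrite /l2 fineK ?len_fin_num.
Qed.

Lemma arclength_param_split1 s : 0 <= s <= l1 ->
  arclength_param gamma s = arclength_param gamma1 s.
Proof.
move=> /path_length_surj[t tab ts].
rewrite (arclength_paramE tab ts) agree1//; apply: arclength_paramE.
  have /andP[a1t tb1] := tab; rewrite -start1 a1t/= (le_trans tb1)//.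
  by rewrite mid -end2 curve_le.
by rewrite path_length1.
Qed.

Lemma arclength_param_split2 s : 0 <= s <= l2 ->
  arclength_param gamma (l1 + s) = arclength_param gamma2 s.
Proof.
move=> /path_length_surj[t tab ts].
rewrite (arclength_paramE tab ts) agree2//; apply: arclength_paramE.
  have /andP[a2t tb2] := tab; rewrite -end2 tb2 andbT (le_trans _ a2t)//.
  by rewrite -start1 -mid curve_le.
by rewrite path_length2// ts -EFinD.
Qed.

Lemma curve_integral_split h : borel_fun h -> (forall x, 0 <= h x)%E ->
  curve_integral h gamma =
  (curve_integral h gamma1 + curve_integral h gamma2)%E.
Proof.
move=> mh h0; rewrite (curve_integral_lenE h len_split).
have mg : measurable_fun `[0%R, l1 + l2] (h \o arclength_param gamma).
  by have := @measurable_arclength_param _ _ _ gamma h mh; rewrite len_split.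
have l10 : 0 <= l1 by exact: len_ge0.
have l20 : 0 <= l2 by exact: len_ge0.
have -> : (`[0%R, l1 + l2] = `[0%R, l1] `|` `]l1, l1 + l2])%classic.
  apply/seteqP; split => s /=; rewrite !in_itv/=.
    by move=> /andP[s0 sl]; case: (leP s l1) => sl1; [left|right]; rewrite ?s0.
  by move=> [/andP[s0 sl]|/andP[sl sl2]]; apply/andP; split; lra.
rewrite ge0_integral_setU//=; last 2 first.
- apply: measurable_funS mg => // s /=; rewrite !in_itv/=.
  by move=> [/andP[s0 sl]|/andP[sl sl2]]; apply/andP; split; lra.
- rewrite disj_set2E; apply/eqP/seteqP; split => // s [] /=; rewrite !in_itv/=.
  by move=> /andP[_ /le_lt_trans H] /andP[/H]; rewrite ltxx.
congr (_ + _)%E.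
  by apply: eq_integral => s; rewrite inE/= in_itv/= => /arclength_param_split1 ->.
have mg2 : measurable_fun `[l1, l1 + l2] (h \o arclength_param gamma).
  apply: measurable_funS mg => // s /=; rewrite !in_itv/=.
  by move=> /andP[sl sl2]; apply/andP; split; lra.
rewrite integral_itv_obnd_cbnd; last first.
  apply: measurable_funS mg2 => // s /=; rewrite !in_itv/=.
  by move=> /andP[/ltW -> ->].
rewrite -(@ge0_integral_shift _ l1 l2)//.
by apply: eq_integral => s; rewrite inE/= in_itv/= => /arclength_param_split2 ->.
Qed.

End Split.

End CurveIntegral.

(** * Operations on curves *)

Section CurveOperations.
Context {d : measure_display} {R : realType} {X : metricMeasurableType d R}.
Implicit Types (gamma : curve X) (h : X -> \bar R).

(** Placing one curve right after another requires its parameter interval to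
    start at a prescribed point. *)
Lemma shift_curve gamma (c : R) : exists gamma',
  [/\ cstart gamma' = c, gamma' c = gamma (cstart gamma),
      gamma' (cend gamma') = gamma (cend gamma) &
      forall h, curve_integral h gamma' = curve_integral h gamma].
Proof.
set a := cstart gamma; set b := cend gamma.
have ab : a <= b := curve_le gamma.
have [|||gamma' [sg eg mg]] := @curveP _ _ _ (fun t => gamma (t + (a - c)))
    c (b + c - a).
- by lra.
- have /within_itv_continuousP cg := @curve_continuous _ _ _ gamma.
  apply/within_itv_continuousP => t /andP[ct tb] r r0.
  rewrite -/a -/b in cg.
  have [|t0 t00 H] := cg (t + (a - c)) _ r r0; first by apply/andP; split; lra.
  exists t0 => // s /andP[cs sb] st; apply: H; first by apply/andP; split; lra.
  by rewrite (_ : _ - _ = s - t)//; lra.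
- rewrite path_length_shift (_ : c + (a - c) = a); last by lra.
  rewrite (_ : b + c - a + (a - c) = b); last by lra.
  by rewrite ltey_eq len_fin_num.
have lg t : path_length c t gamma' = path_length a (t + (a - c)) gamma.
  by rewrite mg path_length_shift; congr path_length; lra.
have leng : len gamma' = len gamma.
  by rewrite /len sg lg eg; congr path_length; rewrite -/b; lra.
exists gamma'; split => // [||h].
- by rewrite mg; congr (cmap gamma _); rewrite -/a; lra.
- by rewrite mg eg; congr (cmap gamma _); rewrite -/b; lra.
rewrite /curve_integral leng; apply: eq_integral => s.
rewrite inE/= in_itv/= -leng => /path_length_surj[t /andP[ct tb] ts].
rewrite (arclength_paramE _ ts) ?ct// mg; congr h; apply/esym.
apply: arclength_paramE; first by apply/andP; split; move: ct tb;
  rewrite ?sg ?eg -/a -/b; lra.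
by rewrite -lg -sg.
Qed.

Lemma reverse_curve gamma : exists gamma',
  [/\ gamma' (cstart gamma') = gamma (cend gamma),
      gamma' (cend gamma') = gamma (cstart gamma) &
      forall h, borel_fun h -> (forall x, 0 <= h x)%E ->
        curve_integral h gamma' = curve_integral h gamma].
Proof.
set a := cstart gamma; set b := cend gamma.
have ab : a <= b := curve_le gamma.
have [|||gamma' [sg eg mg]] := @curveP _ _ _ (fun t => gamma (- t)) (- b) (- a).
- by rewrite lerN2.
- have /within_itv_continuousP cg := @curve_continuous _ _ _ gamma.
  apply/within_itv_continuousP => t /andP[ct tb] r r0.
  have [|t0 t00 H] := cg (- t) _ r r0.
    by apply/andP; split; rewrite -/a -/b; lra.
  exists t0 => // s /andP[cs sb] st; apply: H.
    by apply/andP; split; rewrite -/a -/b; lra.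
  by rewrite -opprD normrN.
- by rewrite path_length_opp ?lerN2// !opprK ltey_eq len_fin_num.
have lg t : - b <= t -> path_length (- b) t gamma' = path_length (- t) b gamma.
  by move=> bt; rewrite mg path_length_opp// opprK.
have leng : len gamma' = len gamma.
  by rewrite /len sg lg eg ?opprK ?lerN2.
exists gamma'; split => // [||h mh h0].
- by rewrite mg sg opprK.
- by rewrite mg eg opprK.
rewrite /curve_integral leng -[RHS]ge0_integral_reflect//; last first.
  exact: measurable_arclength_param.
apply: eq_integral => s.
rewrite inE/= in_itv/= -leng => /path_length_surj[t /andP[ct tb] ts].
rewrite (arclength_paramE _ ts) ?ct// mg; congr h; apply/esym.
move: ct tb ts; rewrite sg eg => ct tb; rewrite lg// => ts.
apply: arclength_paramE; first by apply/andP; rewrite -/a -/b; split; lra.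
have at' : a <= - t by lra.
have tb' : - t <= b by lra.
rewrite leng /len -/a -/b (@path_lengthD _ _ _ a b (- t) gamma)// ts.
by rewrite fineD// ?path_length_fin_num//= addrK fineK// path_length_fin_num.
Qed.

Lemma concat_curve gamma1 gamma2 :
  gamma1 (cend gamma1) = gamma2 (cstart gamma2) ->
  exists gamma,
  [/\ gamma (cstart gamma) = gamma1 (cstart gamma1),
      gamma (cend gamma) = gamma2 (cend gamma2) &
      forall h, borel_fun h -> (forall x, 0 <= h x)%E ->
        curve_integral h gamma =
        (curve_integral h gamma1 + curve_integral h gamma2)%E].
Proof.
have [gamma2' [s2 gs2 ge2 i2]] := shift_curve gamma2 (cend gamma1).
move=> g12; have {g12}gs2 : gamma2' (cend gamma1) = gamma1 (cend gamma1).
  by rewrite g12.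
set a := cstart gamma1; set c := cend gamma1; set b := cend gamma2'.
have ac : a <= c := curve_le gamma1.
have cb : c <= b by have := curve_le gamma2'; rewrite s2.
pose f t := if t <= c then gamma1 t else gamma2' t.
have f1 t : t <= c -> f t = gamma1 t by rewrite /f => ->.
have f2 t : c <= t -> f t = gamma2' t.
  by rewrite /f; case: (ltgtP t c) => // ->.
have [||gamma [sg eg mg]] := @curveP _ _ _ f a b (le_trans ac cb).
- have /within_itv_continuousP c1 := @curve_continuous _ _ _ gamma1.
  have /within_itv_continuousP c2 := @curve_continuous _ _ _ gamma2'.
  apply/within_itv_continuousP => t /andP[at_ tb] r r0.
  have [u u0 uP] : exists2 u : R, 0 < u & forall s, a <= s <= c ->
      `|s - t| < u -> mdist (f t) (f s) < r.
    have [tc|ct] := leP t c.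
      have [|u u0 uP] := c1 t _ r r0; first by rewrite at_.
      by exists u => // s asc su; rewrite !f1 ?uP//; case/andP : asc.
    exists (t - c); first by rewrite subr_gt0.
    by move=> s /andP[_ sc]; rewrite ltr0_norm; lra.
  have [v v0 vP] : exists2 v : R, 0 < v & forall s, c <= s <= b ->
      `|s - t| < v -> mdist (f t) (f s) < r.
    have [ct|tc] := leP c t.
      have [|v v0 vP] := c2 t _ r r0; first by rewrite s2 ct.
      by exists v => // s csb sv; rewrite !f2 ?vP ?s2//; case/andP : csb.
    exists (c - t); first by rewrite subr_gt0.
    by move=> s /andP[cs _]; rewrite gtr0_norm; lra.
  exists (Num.min u v); first by rewrite lt_min u0.
  move=> s /andP[as_ sb]; rewrite lt_min => /andP[su sv].
  have [sc|/ltW cs] := leP s c; first by apply: uP => //; rewrite as_.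
  by apply: vP => //; rewrite cs.
- rewrite (@path_lengthD _ _ _ _ _ c)//.
  rewrite (@eq_path_length _ _ _ _ _ f gamma1); last by move=> t /andP[_ /f1].
  rewrite (@eq_path_length _ _ _ _ _ f gamma2'); last by move=> t /andP[/f2].
  apply: lte_add_pinfty; first by rewrite ltey_eq len_fin_num.
  by rewrite /c -s2 ltey_eq len_fin_num.
exists gamma; split.
- by rewrite sg mg f1.
- by rewrite eg mg f2.
move=> h mh h0; rewrite -i2; apply: curve_integral_split => //.
- by move=> t /andP[_ tc]; rewrite mg f1.
- by rewrite s2 => t /andP[ct _]; rewrite mg f2.
Qed.

Lemma constant_curve (x : X) : exists gamma,
  [/\ gamma (cstart gamma) = x, gamma (cend gamma) = x &
      forall h, curve_integral h gamma = 0%E].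
Proof.
have [||gamma [sg eg mg]] := @curveP _ _ _ (fun=> x) 0 0 (lexx _).
- by apply/within_itv_continuousP => t _ r r0; exists 1 => // s _ _; rewrite mdistxx.
- by rewrite path_lengthxx.
exists gamma; split; rewrite ?mg// => h.
by rewrite /curve_integral /len sg eg path_lengthxx set_itv1 integral_set1.
Qed.

(** Cutting off everything before the last visit of the starting point gives a
    curve that never comes back to it; the values of the integrand there are
    then immaterial. *)
Lemma tail_curve gamma : exists gamma',
  [/\ gamma' (cstart gamma') = gamma (cstart gamma),
      gamma' (cend gamma') = gamma (cend gamma) &
      forall h1 h2, borel_fun h1 -> borel_fun h2 ->
      (forall y, 0 <= h1 y)%E -> (forall y, 0 <= h2 y)%E ->
      (forall y, y <> gamma (cstart gamma) -> h1 y <= h2 y)%E ->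
      (curve_integral h1 gamma' <= curve_integral h2 gamma)%E].
Proof.
set a := cstart gamma; set b := cend gamma; set x := gamma a.
have ab : a <= b := curve_le gamma.
pose T := [set t | a <= t <= b /\ gamma t = x].
have supT : has_sup T.
  split; first by exists a; split => //; rewrite lexx.
  by exists b => t [/andP[]].
pose t0 := sup T.
have at0 : a <= t0 by apply: sup_upper_bound => //; split => //; rewrite lexx.
have t0b : t0 <= b by apply: ge_sup => [|t [/andP[]]//]; case: supT.
(* Points of [T] come arbitrarily close to [t0], so continuity excludes a
   positive distance. *)
have gt0 : gamma t0 = x.
  apply/esym; apply: mdist_positivity; apply/eqP.
  rewrite eq_le mdist_ge0 andbT leNgt; apply/negP => xt0.
  have /within_itv_continuousP cg := @curve_continuous _ _ _ gamma.
  have [|e e0 H] := cg t0 _ _ xt0; first by rewrite at0.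
  have [t [tab tx] tt0] := sup_adherent e0 supT.
  have tt0' : t <= t0 by apply: sup_upper_bound.
  have := H t tab; rewrite tx metric_sym ltxx => H'.
  by apply/notF/H'; rewrite ler0_norm ?subr_le0//; move: tt0; rewrite -/t0; lra.
have [g1 [sg1 eg1 mg1]] := subcurveP (lexx a) at0 t0b.
have [g2 [sg2 eg2 mg2]] := subcurveP at0 t0b (lexx b).
exists g2; split => [||h1 h2 mh1 mh2 h10 h20 h12].
- by rewrite mg2 sg2.
- by rewrite mg2 eg2.
rewrite (@curve_integral_split _ _ _ gamma g1 g2 sg1 _ eg2)// ?sg2 ?mg1 ?mg2//.
apply: le_trans (leeDr _ _); last exact: curve_integral_ge0.
have mi h : borel_fun h ->
    measurable_fun `]0, fine (len g2)] (h \o arclength_param g2).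
  move=> mh; have := @measurable_arclength_param _ _ _ g2 h mh.
  by apply: measurable_funS => //; exact: subset_itv_oc_cc.
(* Only the arc length [0] of [g2] corresponds to the point [x]. *)
rewrite /curve_integral -!integral_itv_obnd_cbnd; [|exact: mi..].
apply: ge0_le_integral => //; [exact: mi|exact: mi|].
move=> s /=; rewrite in_itv/= => /andP[s0 sl].
have [|t] := @path_length_surj _ _ _ g2 s; first by rewrite (ltW s0).
move=> /andP[]; rewrite sg2 eg2 => t0t tb ts.
rewrite (arclength_paramE _ (t := t)) ?sg2 ?eg2 ?t0t//; apply: h12 => g2t.
have tt0 : t <= t0.
  apply: sup_upper_bound => //; split; first by rewrite tb (le_trans at0).
  by rewrite -g2t mg2.
move: ts; have -> : t = t0 by apply/eqP; rewrite eq_le tt0.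
by rewrite path_lengthxx => -[] s0'; rewrite -s0' ltxx in s0.
Qed.

End CurveOperations.

(** * Outer regularity of finite Borel measures *)

Lemma open_mball {R : realType} (X : metricType R) (x : X) (r : R) :
  open (ball x r).
Proof.
rewrite openE => y; rewrite ballEmdist /interior /= => xy.
rewrite -nbhs_ballE; exists (r - mdist x y) => /=; first by rewrite subr_gt0.
move=> z; rewrite ballEmdist/= => yz.
by rewrite (le_lt_trans (metric_triangle x y z))// -ltrBrDl.
Qed.

Section Regularity.
Context {d : measure_display} {R : realType} {X : metricMeasurableType d R}.
Variable nu : {measure set X -> \bar R}.
Hypothesis nu_fin : (nu setT < +oo)%E.
Hypothesis borel_measurable : borel_set `<=` (measurable : set (set X)).
Implicit Types (E F G U : set X).

Let open_borel_measurable U : open U -> measurable U.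
Proof. by move=> oU; apply: borel_measurable; exact: sub_sigma_algebra. Qed.

Let closed_borel_measurable F : closed F -> measurable F.
Proof.
move=> /closed_openC/open_borel_measurable/measurableC.
by rewrite setCK.
Qed.

Lemma measure_small_tail (G_ : (set X)^nat) (e : R) : 0 < e ->
  (forall n, measurable (G_ n)) -> (forall n, G_ n.+1 `<=` G_ n) ->
  \bigcap_n G_ n = set0 -> exists n, (nu (G_ n) <= e%:E)%E.
Proof.
move=> e0 mG dG G0.
have G0fin : (nu (G_ 0%N) < +oo)%E.
  by apply: le_lt_trans nu_fin; apply: le_measure; rewrite ?inE.
have := nonincreasing_cvg_mu G0fin mG.
rewrite G0 measure0 => /(_ measurable0) H.
have {H}/H : {homo G_ : n m / (n <= m)%N >-> (m <= n)%O}.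
  by apply/nonincreasing_seqP => n; apply/subsetPset.
move=> /fine_cvgP[_ /cvgrPdist_le/(_ e e0)[N _ H]]; exists N.
have := H N (leqnn N); rewrite /= sub0r normrN.
have mGN : nu (G_ N) \is a fin_num.
  rewrite ge0_fin_numE//; apply: le_lt_trans nu_fin.
  by apply: le_measure; rewrite ?inE.
by rewrite ger0_norm ?fine_ge0// -lee_fin fineK.
Qed.

Let approx E := forall e : R, 0 < e -> exists F U,
  [/\ closed F, open U, F `<=` E, E `<=` U & (nu (U `\` F) <= e%:E)%E].

Let open_approx : (@open X) `<=` approx.
Proof.
move=> G oG e e0.
(* The closed sets inside [G] are the complements of the neighbourhoods of
   radius [1 / (n + 1)] of the complement of [G]. *)
pose V n := \bigcup_(z in ~` G) ball z (n.+1%:R^-1 : R).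
have oV n : open (V n).
  by apply: bigcup_open => z _; exact: open_mball.
have [n Hn] : exists n, (nu (G `&` V n) <= e%:E)%E.
  apply: measure_small_tail => //.
  - by move=> n; apply: measurableI; exact: open_borel_measurable.
  - move=> n y [Gy [z Gz zy]]; split => //; exists z => //.
    by apply: le_ball zy; rewrite lef_pV2 ?posrE// ler_nat.
  - apply/seteqP; split => // y H.
    have [Gy _] := H 0%N I.
    have := open_nbhs_nbhs (conj oG Gy).
    rewrite -nbhs_ballE => -[r /= r0 rG].
    have [n rn] := ltr_add_invr r0.
    rewrite add0r in rn.
    have [_ [z Gz zy]] := H n I.
    by apply: Gz; apply: rG; apply: ball_sym; apply: le_ball zy; exact: ltW.
exists (~` V n), G; split => //.
- exact: open_closedC.
- move=> y Vy; apply: contrapT => Gy; apply: Vy; exists y => //.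
  by apply: ballxx; rewrite invr_gt0.
- by rewrite setDE setCK.
Qed.

Let approx_setC E : approx E -> approx (setT `\` E).
Proof.
rewrite setTD => aE e /aE[F [U [cF oU FE EU UF]]].
exists (~` U), (~` F); split; [exact: open_closedC|exact: closed_openC| | |].
- exact: subsetC.
- exact: subsetC.
- by rewrite setDE setCK setIC -setDE.
Qed.

Let approx_bigcup (E_ : (set X)^nat) : (forall n, approx (E_ n)) ->
  approx (\bigcup_n E_ n).
Proof.
move=> aE e e0; have e20 : 0 < e / 2 by rewrite divr_gt0.
have /choice[F_] : forall n, exists F, exists U, [/\ closed F, open U,
    F `<=` E_ n, E_ n `<=` U & (nu (U `\` F) <= (e / 2 / (2 ^ n.+1)%:R)%:E)%E].
  by move=> n; apply: aE; rewrite divr_gt0// ltr0n expn_gt0.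
move=> /choice[U_ FU].
have mU n : measurable (U_ n).
  by case: (FU n) => ? ? ? ? ?; exact: open_borel_measurable.
have mF n : measurable (F_ n).
  by case: (FU n) => ? ? ? ? ?; exact: closed_borel_measurable.
pose K n := \big[setU/set0]_(i < n) F_ i.
have mK n : measurable (K n) by exact: bigsetU_measurable.
have mFF : measurable (\bigcup_n F_ n) by exact: bigcupT_measurable.
have mUU : measurable (\bigcup_n U_ n) by exact: bigcupT_measurable.
have [n Hn] : exists n, (nu ((\bigcup_k F_ k) `\` K n) <= (e / 2)%:E)%E.
  apply: measure_small_tail => //.
  - by move=> n; exact: measurableD.
  - by move=> n; apply: setDS; rewrite /K big_ord_recr/=; exact: subsetUl.
  - apply/seteqP; split => // y H; have [[k _ Fky] _] := H 0%N I.
    have [_ +] := H k.+1 I; apply.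
    by rewrite /K big_ord_recr/=; right.
exists (K n), (\bigcup_n U_ n); split.
- by rewrite /K; apply: closed_bigsetU => i _; case: (FU i).
- by apply: bigcup_open => i _; case: (FU i).
- rewrite /K => y; rewrite -bigcup_mkord => -[i _ Fiy]; exists i => //.
  by case: (FU i) => _ _ + _ _; apply.
- by move=> y [i _ Eiy]; exists i => //; case: (FU i) => _ _ _ + _; apply.
apply: (@le_trans _ _ (nu ((\bigcup_n U_ n `\` \bigcup_n F_ n)
    `|` (\bigcup_n F_ n `\` K n)))).
  apply: le_measure; rewrite ?inE.
  - exact: measurableD.
  - by apply: measurableU; exact: measurableD.
  - move=> y [Uy Ky]; have [Fy|Fy] := pselect ((\bigcup_n F_ n) y).
      by right.
    by left.
apply: (le_trans (measureU2 _ _ _)); [exact: measurableD|exact: measurableD|].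
rewrite [e]splitr EFinD leeD//.
apply: (@le_trans _ _ (\sum_(n <oo) nu (U_ n `\` F_ n))%E).
  apply: measure_sigma_subadditive => //.
  - by move=> k; exact: measurableD.
  - exact: measurableD.
  - move=> y [[k _ Uky] Fy]; exists k => //; split => // Fky.
    by apply: Fy; exists k.
apply: (le_trans _ (epsilon_trick0 xpredT (ltW e20))).
by apply: lee_nneseries => // k _; case: (FU k).
Qed.

(** Finite Borel measures on a metric space are outer regular, because the sets
    squeezed between closed and open sets up to small measure form a
    sigma-algebra. *)
Lemma borel_outer_regular E (e : R) : borel_set E -> 0 < e ->
  exists U, [/\ open U, E `<=` U & (nu (U `\` E) <= e%:E)%E].
Proof.
move=> bE; have aE : approx E.
  apply: (smallest_sub (C := sigma_algebra setT) _ open_approx bE).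
  split; [apply: open_approx; exact: open0|exact: approx_setC|].
  exact: approx_bigcup.
move=> /aE[F [U [cF oU FE EU UF]]]; exists U; split => //.
apply: le_trans UF; apply: le_measure; rewrite ?inE; last exact: setDS.
- by apply: measurableD; [exact: open_borel_measurable|exact: borel_measurable].
- by apply: measurableD; [exact: open_borel_measurable|
    exact: closed_borel_measurable].
Qed.

(** Outer regularity with an error that is small relative to every ball around
    [x] at once: on the part of [E] outside the ball of radius [rho / 2 ^ n] the
    error is measured against the mass of that ball. *)
Lemma borel_outer_regular_at (x : X) (rho : R) E (e : R) : 0 < rho ->
  (forall r, 0 < r -> r <= rho -> (0 < nu (ball x r))%E) ->
  borel_set E -> ~ E x -> 0 < e ->
  exists U, [/\ open U, E `<=` U & forall r, 0 < r -> r <= rho ->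
    (nu (ball x r `&` (U `\` E)) <= e%:E * nu (ball x r))%E].
Proof.
move=> rho0 nu0 bE Ex e0.
pose s n : R := rho / (2 ^ n)%:R.
have s0 n : 0 < s n by rewrite divr_gt0// ltr0n expn_gt0.
have sle n : s n <= rho.
  rewrite ler_pdivrMr ?ltr0n ?expn_gt0// ler_peMr ?(ltW rho0)//.
  by rewrite ler1n expn_gt0.
pose V n := [set y | s n < mdist x y].
have oV n : open (V n).
  rewrite openE => y; rewrite /V/= /interior => xy; rewrite -nbhs_ballE.
  exists (mdist x y - s n) => /=; first by rewrite subr_gt0.
  move=> z; rewrite ballEmdist/= => yz; rewrite ltrBrDr in yz.
  have := metric_triangle x z y; rewrite (metric_sym z y); lra.
have nufin A : measurable A -> nu A \is a fin_num.
  move=> mA; rewrite ge0_fin_numE//; apply: le_lt_trans nu_fin.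
  by apply: le_measure; rewrite ?inE.
have mball r : measurable (ball x r).
  by apply: open_borel_measurable; exact: open_mball.
have mE : measurable E by exact: borel_measurable.
have /choice[U_ UP] : forall n, exists U, [/\ open U, E `&` V n `<=` U &
   (nu (U `\` (E `&` V n)) <= (e / (2 ^ n.+1)%:R * fine (nu (ball x (s n))))%:E)%E].
  move=> n; apply: borel_outer_regular.
    apply: (@measurableI _ (g_sigma_algebraType (@open X))) => //.
    exact: sub_sigma_algebra.
  rewrite mulr_gt0 ?divr_gt0 ?ltr0n ?expn_gt0// fine_gt0// nu0//=.
  by rewrite ltey_eq nufin.
have mU n : measurable (U_ n `&` V n).
  by apply: open_borel_measurable; apply: openI => //; case: (UP n).
exists (\bigcup_n (U_ n `&` V n)); split.
- by apply: bigcup_open => n _; apply: openI => //; case: (UP n).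
- move=> y Ey; have xy : 0 < mdist x y.
    by rewrite mdist_gt0; apply/eqP => xy; apply: Ex; rewrite xy.
  have [n sn] : exists n, s n < mdist x y.
    have [k] : exists k, 0 + k.+1%:R^-1 < mdist x y / rho.
      by apply: ltr_add_invr; rewrite divr_gt0.
    rewrite add0r ltr_pdivlMr// => kxy; exists k.+1.
    apply: le_lt_trans kxy; rewrite /s mulrC ler_pM2r// lef_pV2 ?posrE ?ltr0n ?expn_gt0//.
    by rewrite ler_nat ltnW// ltn_expl.
  exists n => //; split => //; case: (UP n) => _ + _; apply; split => //.
move=> r r0 rrho.
apply: (@le_trans _ _ (\sum_(n <oo)
    nu (ball x r `&` ((U_ n `&` V n) `\` E)))%E).
  apply: measure_sigma_subadditive => //.
  - by move=> n; apply: measurableI => //; exact: measurableD.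
  - apply: measurableI => //; apply: measurableD => //.
    by apply: bigcupT_measurable.
  - by move=> y [xy [[n _ Uny] Ey]]; exists n.
apply: (@le_trans _ _
    (\sum_(n <oo) (e * fine (nu (ball x r)) / (2 ^ n.+1)%:R)%:E)%E); last first.
  apply: (le_trans (epsilon_trick0 _ _)).
    by rewrite mulr_ge0 ?fine_ge0// ltW.
  by rewrite EFinM fineK// nufin.
apply: lee_nneseries => // n _.
have [rs|sr] := leP r (s n).
  rewrite (_ : _ `&` _ = set0) ?measure0.
    by rewrite lee_fin divr_ge0// mulr_ge0 ?fine_ge0// ltW.
  apply/seteqP; split => // y []; rewrite ballEmdist/= => xy [[_ sxy] _].
  by move: (lt_trans xy (le_lt_trans rs sxy)); rewrite ltxx.
have [oUn EUn nUn] := UP n.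
apply: (@le_trans _ _ (nu (U_ n `\` (E `&` V n)))).
  apply: le_measure; rewrite ?inE.
  - by apply: measurableI => //; exact: measurableD.
  - apply: measurableD; first exact: open_borel_measurable.
    by apply: measurableI => //; exact: open_borel_measurable.
  - by move=> y [_ [[Uy Vy] Ey]]; split => // -[].
apply: (le_trans nUn); rewrite lee_fin mulrAC ler_pM2r ?invr_gt0 ?ltr0n ?expn_gt0//.
rewrite ler_pM2l// fine_le ?nufin//; apply: le_measure; rewrite ?inE//.
exact/le_ball/ltW.
Qed.

End Regularity.

(** * Lower semicontinuous majorants *)

Section WeightedMeasure.
Context {d : measure_display} {R : realType} {X : metricMeasurableType d R}.
Variables (mu : {measure set X -> \bar R}) (w : X -> \bar R).
Hypotheses (mw : measurable_fun setT w) (w0 : forall x, (0 <= w x)%E).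

Let wmeasure0 : wmeasure mu w set0 = 0%E.
Proof. by rewrite /wmeasure integral_set0. Qed.

Let wmeasure_ge0 A : (0 <= wmeasure mu w A)%E.
Proof. exact: integral_ge0. Qed.

Let wmeasure_semi_sigma_additive : semi_sigma_additive (wmeasure mu w).
Proof. exact: semi_sigma_additive_nng_induced. Qed.

HB.instance Definition _ := isMeasure.Build _ _ _ (wmeasure mu w)
  wmeasure0 wmeasure_ge0 wmeasure_semi_sigma_additive.

(** The measure structure depends on the hypotheses on [w]; this form makes it
    available for a weight cut off outside a ball. *)
Lemma wmeasure_is_measure :
  exists nu : {measure set X -> \bar R}, nu = wmeasure mu w :> (_ -> _).
Proof. by exists (wmeasure mu w). Qed.

Lemma integral_layers_weight (N : nat) (c : R) (A_ : 'I_N -> set X) (D : set X) :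
  0 <= c -> (forall i, measurable (A_ i)) -> measurable D ->
  (\int[mu]_(y in D) ((\sum_(i < N) c * \1_(A_ i) y)%:E * w y) =
   \sum_(i < N) c%:E * wmeasure mu w (D `&` A_ i))%E.
Proof.
move=> c0 mA mD.
have mwA i : measurable_fun D (w \_ (A_ i)).
  by apply/(measurable_restrict _ _ _) => //; exact: measurable_funS mw.
transitivity (\int[mu]_(y in D) (\sum_(i < N) c%:E * (w \_ (A_ i)) y))%E.
  apply: eq_integral => y _; rewrite -sumEFin ge0_sume_distrl; last first.
    by move=> i _; rewrite lee_fin mulr_ge0.
  apply: eq_bigr => i _; rewrite EFinM -muleA patchE indicE.
  by case: (y \in A_ i); rewrite ?mul1e ?mul0e.
rewrite ge0_integral_sum//; last 2 first.
- by move=> i; apply: measurable_funeM.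
- by move=> i y _; rewrite mule_ge0// erestrict_ge0.
apply: eq_bigr => i _; rewrite ge0_integralZl//.
- by rewrite /wmeasure integral_mkcondr.
- by move=> y _; rewrite erestrict_ge0.
Qed.

End WeightedMeasure.

(** For [0 < t <= N c] the sum below is [c] times the ceiling of [t / c]. *)
Lemma layer_sum_bounds {R : realType} (c t : R) (N : nat) : 0 < c -> 0 <= t ->
  let S := \sum_(i < N) c * (((i : nat)%:R * c < t)%R)%:R in
  (t <= N%:R * c -> t <= S) /\ S <= t + c.
Proof.
move=> c0 t0 /=; suff [? ? ? ?] : let S := \sum_(i < N) c * (((i : nat)%:R * c < t)%R)%:R in
    [/\ t <= N%:R * c -> t <= S, N%:R * c <= t -> N%:R * c <= S,
        S <= N%:R * c & S <= t + c] by [].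
elim: N => [|N /= [ih1 ih2 ih3 ih4]].
  by rewrite big_ord0 mul0r; split; lra.
rewrite big_ord_recr/= -natr1 mulrDl mul1r.
case: (ltP (N%:R * c) t) => Nt; rewrite ?mulr1 ?mulr0 ?addr0; split; try lra.
Qed.

(** Vitali-Caratheodory approximation from above by a lower semicontinuous
    function, with an error controlled relative to every small ball around [x]
    simultaneously; the price is that the value at [x] itself is lost.  The
    function is a layer-cake sum over open supersets of the superlevel sets. *)
Lemma lsc_majorant_off_point {d : measure_display} {R : realType}
    {X : metricMeasurableType d R}
    (mu : {measure set X -> \bar R}) (w : X -> \bar R) (x : X) (rho K e : R)
    (f : X -> R) :
  borel_set `<=` (measurable : set (set X)) ->
  borel_fun w -> (forall y, 0 <= w y)%E -> 0 < rho ->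
  (wmeasure mu w (ball x rho) < +oo)%E ->
  (forall r, 0 < r -> r <= rho -> (0 < wmeasure mu w (ball x r))%E) ->
  borel_fun (EFin \o f) -> (forall y, 0 <= f y <= K) -> 0 < e ->
  exists f' : X -> R, [/\ forall y, 0 <= f' y, exists M, forall y, f' y <= M,
    forall y, \forall z \near y, f' y <= f' z,
    forall y, y <> x -> f y <= f' y &
    forall r, 0 < r -> r <= rho ->
      (\int[mu]_(y in ball x r) ((f' y)%:E * w y) <=
       \int[mu]_(y in ball x r) ((f y)%:E * w y)
         + e%:E * wmeasure mu w (ball x r))%E].
Proof.
move=> bmX bw w0 rho0 wfin wpos bf f0K e0.
have mborel (h : X -> \bar R) : borel_fun h -> measurable_fun setT h.
  by move=> bh _ B mB; apply: bmX; exact: (bh measurableT B mB).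
have mw := mborel _ bw; have mf := mborel _ bf.
have mo (U : set X) : open U -> measurable U.
  by move=> oU; apply: bmX; exact: sub_sigma_algebra.
have mball r : measurable (ball x r) by apply: mo; exact: open_mball.
have [nu nuE] : exists nu : {measure set X -> \bar R},
    nu = wmeasure mu (w \_ (ball x rho)) :> (_ -> _).
  apply: wmeasure_is_measure; last exact: erestrict_ge0.
  by apply: (measurable_restrictT _ (mball rho)).1; exact: measurable_funS mw.
have nu_ball A : A `<=` ball x rho -> nu A = wmeasure mu w A.
  by move=> AB; rewrite nuE /wmeasure -integral_mkcondr setIidl.
have wge0 A : (0 <= wmeasure mu w A)%E by exact: integral_ge0.
have le_rho r : r <= rho -> ball x r `<=` ball x rho by exact: le_ball.
pose c := e / 2; have c0 : 0 < c by rewrite divr_gt0.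
pose N := (Num.truncn (K / c)).+1.
have NK : K <= N%:R * c.
  by rewrite -ler_pdivrMr// ltW// /N truncnS_gt.
pose E_ (i : nat) := [set y | i%:R * c < f y] `\ x.
have bE i : borel_set (E_ i).
  apply: (@measurableD _ (g_sigma_algebraType (@open X))); last first.
    rewrite -(setCK [set x]); apply: (@measurableC _ (g_sigma_algebraType (@open X))).
    apply: sub_sigma_algebra; apply: closed_openC.
    by apply: accessible_closed_set1; apply: hausdorff_accessible;
      exact: metric_hausdorff.
  have := bf measurableT `](i%:R * c)%:E, +oo[%classic (emeasurable_itv _).
  rewrite setTI; congr (measurable _); apply/seteqP; split => y /=;
  by rewrite in_itv/= andbT lte_fin.
(* The [N] layers of height [c] contribute [N c eta = c] to the error, and
   rounding up to a multiple of [c] contributes another [c]. *)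
pose eta := c / (N%:R * c); have eta0 : 0 < eta by rewrite divr_gt0// mulr_gt0// ltr0n.
have /choice[U_ UP] : forall i, exists U, [/\ open U, E_ i `<=` U &
    forall r, 0 < r -> r <= rho ->
    (nu (ball x r `&` (U `\` E_ i)) <= eta%:E * nu (ball x r))%E].
  move=> i; apply: (borel_outer_regular_at (nu := nu) _ bmX rho0) => //.
  - by rewrite nuE /wmeasure -integral_mkcondr setTI.
  - by move=> r r0 rrho; rewrite nu_ball ?wpos//; exact: le_rho.
  - by move=> [_ /(_ erefl)].
have oU i : open (U_ i) by case: (UP i).
exists (fun y => \sum_(i < N) c * \1_(U_ i) y); split.
- by move=> y; apply: sumr_ge0 => i _; rewrite mulr_ge0// ltW.
- exists (\sum_(i < N) c) => y; apply: ler_sum => i _.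
  by rewrite indicE ler_piMr ?(ltW c0)//; case: (_ \in _); rewrite ?lexx ?ler01.
- move=> y.
  have : \forall z \near y, forall i : 'I_N, U_ i y -> U_ i z.
    apply: filter_forall => i; apply: filter_imply => Uy.
    exact: open_nbhs_nbhs.
  apply: filterS => z H; apply: ler_sum => i _; rewrite ler_pM2l//.
  rewrite !indicE; case: (boolP (y \in U_ i)); last by rewrite ler0n.
  by rewrite inE => /H Uz; rewrite mem_set.
- move=> y yx; have /andP[fy0 fyK] := f0K y.
  have [/(_ (le_trans fyK NK)) H _] := @layer_sum_bounds _ c (f y) N c0 fy0.
  apply: (le_trans H); apply: ler_sum => i _; rewrite ler_pM2l//.
  case: ltP => ify; last by rewrite ler0n.
  by rewrite indicE mem_set//; case: (UP i) => _ + _; apply.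
move=> r r0 rrho; have Br := le_rho _ rrho.
have mU i : measurable (U_ i) by exact: mo.
have mE i : measurable (E_ i) by exact: bmX.
rewrite integral_layers_weight//; last exact: ltW.
have step (i : 'I_N) : (wmeasure mu w (ball x r `&` U_ i) <=
    wmeasure mu w (ball x r `&` E_ i) + eta%:E * wmeasure mu w (ball x r))%E.
  rewrite -!nu_ball//; try by apply: subset_trans Br => ? [].
  apply: (@le_trans _ _ (nu ((ball x r `&` E_ i)
      `|` (ball x r `&` (U_ i `\` E_ i))))).
    apply: le_measure; rewrite ?inE.
    - exact: measurableI.
    - by apply: measurableU; apply: measurableI => //; exact: measurableD.
    - move=> y [By Uy]; have [Ey|Ey] := pselect (E_ i y); first by left.
      by right.
  apply: (le_trans (measureU2 _ _ _)); [exact: measurableI| |].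
    by apply: measurableI => //; exact: measurableD.
  by rewrite leeD2l//; case: (UP i) => _ _; apply.
apply: (@le_trans _ _ (\sum_(i < N) c%:E * (wmeasure mu w (ball x r `&` E_ i)
    + eta%:E * wmeasure mu w (ball x r)))%E).
  by apply: lee_sum => i _; rewrite lee_pmul2l ?lte_fin.
set W := wmeasure mu w (ball x r).
have Wfin : W \is a fin_num.
  rewrite ge0_fin_numE ?wge0// /W -nu_ball//; apply: le_lt_trans wfin.
  by rewrite -nu_ball//; apply: le_measure; rewrite ?inE.
under eq_bigr do rewrite ge0_muleDr ?wge0// ?mule_ge0 ?wge0 ?lee_fin ?(ltW eta0)//.
rewrite big_split/=.
have -> : (\sum_(i < N) c%:E * (eta%:E * W) = c%:E * W)%E.
  rewrite -(fineK Wfin) -!EFinM sumEFin sumr_const card_ord -mulr_natl.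
  by congr EFin; rewrite /eta; field; rewrite ?pnatr_eq0 ?gt_eqF.
have -> : (e%:E * W = c%:E * W + c%:E * W)%E.
  by rewrite -ge0_muleDl ?lee_fin ?(ltW c0)// -EFinD -splitr.
rewrite addeA leeD2r// -integral_layers_weight//; last exact: ltW.
have -> : (c%:E * W = \int[mu]_(y in ball x r) (c%:E * w y))%E.
  by rewrite ge0_integralZl ?lee_fin ?(ltW c0)//; exact: measurable_funS mw.
have mwr : measurable_fun (ball x r) w by exact: measurable_funS mw.
have mfr : measurable_fun (ball x r) (EFin \o f) by exact: measurable_funS mf.
rewrite -ge0_integralD//; last 4 first.
- by move=> y _; rewrite mule_ge0// lee_fin; case/andP: (f0K y).
- exact: emeasurable_funM.
- by move=> y _; rewrite mule_ge0// lee_fin ltW.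
- exact: measurable_funeM.
apply: ge0_le_integral => //.
- by move=> y _; rewrite mule_ge0// lee_fin sumr_ge0// => i _; rewrite mulr_ge0// ltW.
- apply: emeasurable_funM => //; apply/measurable_EFinP.
  apply: measurable_sum => i; apply: measurable_funM => //.
- by apply: emeasurable_funD; [exact: emeasurable_funM|exact: measurable_funeM].
move=> y _; have /andP[fy0 fyK] := f0K y.
rewrite -ge0_muleDl ?lee_fin ?(ltW c0)// lee_wpmul2r// -EFinD lee_fin.
have [_] := @layer_sum_bounds _ c (f y) N c0 fy0; apply: le_trans.
apply: ler_sum => i _; rewrite ler_pM2l// indicE.
case: (boolP (y \in E_ i)); last by rewrite ler0n.
by rewrite inE => -[/= -> _].
Qed.

(** * The maximal function *)

Section Maximal.
Context {d : measure_display} {R : realType} {X : metricMeasurableType d R}.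
Variables (mu : {measure set X -> \bar R}) (Omega : set X) (p : R)
  (w : X -> \bar R) (kappa : R) (x : X).
Hypotheses (p1 : 1 <= p) (kappa0 : 0 < kappa)
  (dx0 : 0 < dist_to (~` Omega) x) (w0 : forall y, (0 <= w y)%E)
  (wball : forall r, 0 < r -> r <= kappa * dist_to (~` Omega) x ->
     (0 < wmeasure mu w (ball x r) < +oo)%E).
Implicit Types (f : X -> \bar R) (m : R).

Lemma maximal_ge0 f : (0 <= maximal mu Omega p w kappa f x)%E.
Proof.
apply: le_trans (ereal_sup_ubound _); last first.
  exists (kappa * dist_to (~` Omega) x / 2) => //=.
  by rewrite divr_gt0 ?mulr_gt0//= ltr_pdivrMr// ltr_pMr ?mulr_gt0// ltr1n.
exact: poweR_ge0.
Qed.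

(** Turns bounds on the maximal function into inequalities between integrals,
    free of roots and quotients. *)
Lemma maximal_leP f m : 0 <= m ->
  (maximal mu Omega p w kappa f x <= m%:E)%E <->
  forall r, 0 < r < kappa * dist_to (~` Omega) x ->
    (\int[mu]_(y in ball x r) (`|f y| `^ p * w y)
     <= (m `^ p)%:E * wmeasure mu w (ball x r))%E.
Proof.
move=> m0; have p0 : 0 < p by rewrite (lt_le_trans _ p1).
set rho := kappa * _.
have int0 r : (0 <= \int[mu]_(y in ball x r) (`|f y| `^ p * w y))%E.
  by apply: integral_ge0 => y _; rewrite mule_ge0// poweR_ge0.
have key r : 0 < r < rho ->
    ((((wmeasure mu w (ball x r))^-1
      * \int[mu]_(y in ball x r) (`|f y| `^ p * w y)) `^ p^-1 <= m%:E) <->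
     (\int[mu]_(y in ball x r) (`|f y| `^ p * w y)
     <= (m `^ p)%:E * wmeasure mu w (ball x r)))%E.
  move=> /andP[r0 rrho]; have /andP[W0 Wy] := wball r0 (ltW rrho).
  have : wmeasure mu w (ball x r) \is a fin_num by rewrite ge0_fin_numE// ltW.
  case: (wmeasure mu w (ball x r)) W0 {Wy} => // W; rewrite lte_fin => W0 _.
  rewrite inver gt_eqF// muleC; set I := integral _ _ _.
  have I0 : (0 <= I * (W^-1)%:E)%E.
    by rewrite mule_ge0 ?int0// lee_fin invr_ge0 ltW.
  have meq : m%:E = ((m `^ p)%:E `^ p^-1)%E.
    by rewrite poweR_EFin -powRrM mulfV ?gt_eqF// powRr1.
  rewrite -lee_pdivrMr//; split => [H|H].
    have -> : (I * (W^-1)%:E = (((I * (W^-1)%:E) `^ p^-1) `^ p))%E.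
      by rewrite -poweRrM mulVf ?gt_eqF// poweRe1.
    rewrite -poweR_EFin; apply: gt0_ler_poweR H; first exact: ltW.
      by rewrite in_itv/= poweR_ge0 leey.
    by rewrite in_itv/= lee_fin m0 leey.
  rewrite meq; apply: gt0_ler_poweR H; first by rewrite invr_ge0 ltW.
    by rewrite in_itv/= I0 leey.
  by rewrite in_itv/= lee_fin powR_ge0 leey.
split => [H r rr|H].
  by apply/key => //; apply: le_trans H; apply: ereal_sup_ubound; exists r.
by apply: ge_ereal_sup => _ [r rr <-]; apply/key => //; exact: H.
Qed.

(** A bound by the maximal function need only be proved with strictly larger
    real numbers [m'] in its place.  This leaves room for an approximation
    error, and covers the cases where the maximal function is [0] or [+oo]. *)
Lemma le_mul_maximal f (v : \bar R) (C : R) : 0 < C ->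
  (forall m m', 0 <= m -> (maximal mu Omega p w kappa f x <= m%:E)%E ->
     m < m' -> (v <= (C * m')%:E)%E) ->
  (v <= C%:E * maximal mu Omega p w kappa f x)%E.
Proof.
move=> C0; have := maximal_ge0 f.
case: (maximal _ _ _ _ _ _ _) => [m||]//; last by rewrite gt0_muley ?leey// lte_fin.
rewrite lee_fin => m0 H; apply/lee_addgt0Pr => e e0.
have := H m (m + e / C) m0 (lexx _); rewrite ltrDl divr_gt0// => /(_ isT).
by rewrite mulrDr mulrCA mulfV ?gt_eqF// mulr1 EFinD EFinM.
Qed.

End Maximal.

Section BorelFunctions.
Context {d : measure_display} {R : realType} {X : metricMeasurableType d R}.

Lemma borel_fun_lower_semicontinuous (f : X -> \bar R) :
  lower_semicontinuous f -> borel_fun f.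
Proof.
move=> /lower_semicontinuousP lf.
apply: (measurability _ (ErealGenOInfty.measurableE R)) => //.
move=> _ [_ [a ->]] <-; rewrite setTI preimage_itvoy.
by apply: sub_sigma_algebra; exact: lf.
Qed.

Lemma borel_fun_measurable (f : X -> \bar R) :
  borel_set `<=` (measurable : set (set X)) -> borel_fun f ->
  measurable_fun setT f.
Proof. by move=> bm bf _ B mB; apply: bm; exact: (bf measurableT B mB). Qed.

Lemma dist_to_gt0 (Omega : set X) (x : X) : open Omega -> ~` Omega !=set0 ->
  Omega x -> 0 < dist_to (~` Omega) x.
Proof.
move=> oO [z Oz] Ox; have := open_nbhs_nbhs (conj oO Ox).
rewrite -nbhs_ballE => -[r /= r0 rO]; rewrite (lt_le_trans r0)//.
apply: lb_le_inf; first by exists (mdist x z); exists z.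
move=> _ [y Oy <-]; rewrite leNgt; apply/negP => xy; apply: Oy; apply: rO.
by rewrite ballEmdist.
Qed.

End BorelFunctions.

(** * Infimum of curve integrals and the equivalence *)

Section CurveInfimum.
Context {d : measure_display} {R : realType} {X : metricMeasurableType d R}.
Variables (CQC : R) (E : set X) (h : X -> \bar R) (K : R).
Hypotheses (hQC : quasiconvex X CQC) (E0 : E !=set0)
  (bh : borel_fun h) (h0 : forall y, (0 <= h y)%E) (hK : forall y, (h y <= K%:E)%E).

(** The [h]-weighted distance to [E]. *)
Definition curve_inf (y : X) : \bar R :=
  ereal_inf [set curve_integral h gamma |
    gamma in [set gamma : curve X | gamma (cstart gamma) = y /\
                                    E (gamma (cend gamma))]].

Lemma curve_inf_ge0 y : (0 <= curve_inf y)%E.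
Proof.
by apply: le_ereal_inf_tmp => _ [gamma _ <-]; exact: curve_integral_ge0.
Qed.

Lemma curve_integral_fin_num (gamma : curve X) : curve_integral h gamma \is a fin_num.
Proof.
rewrite ge0_fin_numE ?curve_integral_ge0//.
apply: le_lt_trans (curve_integral_le _ bh h0 hK) _.
by rewrite -(fineK (len_fin_num gamma)) -EFinM ltry.
Qed.

Lemma curve_inf_fin_num y : curve_inf y \is a fin_num.
Proof.
rewrite ge0_fin_numE ?curve_inf_ge0//.
have [z Ez] := E0; have [gamma [gy gz _]] := hQC y z.
apply: (@le_lt_trans _ _ (curve_integral h gamma)).
  by apply: ereal_inf_lbound; exists gamma => //; rewrite /= gz.
by rewrite ltey_eq curve_integral_fin_num.
Qed.

(** Prepending [gamma] to a competitor for its endpoint gives a competitor for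
    its starting point. *)
Lemma curve_inf_le (gamma : curve X) : (curve_inf (gamma (cstart gamma)) <=
  curve_integral h gamma + curve_inf (gamma (cend gamma)))%E.
Proof.
rewrite -leeBlDl ?curve_integral_fin_num//.
apply: le_ereal_inf_tmp => _ [gamma2 [g2 Eg2] <-].
rewrite leeBlDl ?curve_integral_fin_num//.
have [gamma' [gs ge gi]] := concat_curve (esym g2).
by rewrite -gi//; apply: ereal_inf_lbound; exists gamma' => //=; rewrite ge.
Qed.

Lemma curve_inf_mem y : E y -> curve_inf y = 0%E.
Proof.
move=> Ey; apply/eqP; rewrite eq_le curve_inf_ge0 andbT.
have [gamma [gs ge g0]] := constant_curve y; rewrite -(g0 h).
by apply: ereal_inf_lbound; exists gamma => //=; rewrite ge.
Qed.

Let u y := fine (curve_inf y).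

(** The two inequalities between the end values come from [gamma] and from its
    reversal. *)
Lemma curve_inf_upper_gradient : upper_gradient u h.
Proof.
split => // gamma.
have uE y : curve_inf y = (u y)%:E by rewrite /u fineK ?curve_inf_fin_num.
have [gamma' [gs ge gi]] := reverse_curve gamma.
have := curve_inf_le gamma; have := curve_inf_le gamma'.
rewrite gi// gs ge.
rewrite !uE -(fineK (curve_integral_fin_num gamma)) -!EFinD !lee_fin.
by move=> H1 H2; rewrite ler_norml; apply/andP; split; lra.
Qed.

Lemma curve_inf_Lip0 : Lip0 (~` E) u.
Proof.
split; last by move=> y /contrapT Ey; rewrite /u curve_inf_mem.
exists (K * CQC) => y z; have [gamma [gy gz lg]] := hQC y z.
have [_ _ /(_ gamma)] := curve_inf_upper_gradient; rewrite gy gz => H.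
rewrite -lee_fin (le_trans H)// (le_trans (curve_integral_le _ bh h0 hK))//.
have K0 : 0 <= K by rewrite -lee_fin (le_trans (h0 y)).
by rewrite -mulrA EFinM lee_wpmul2l.
Qed.

End CurveInfimum.

Lemma powR_add_le {R : realType} (p s t : R) : 0 <= p -> 0 <= s -> 0 <= t ->
  (s + t) `^ p <= 2 `^ p * (s `^ p + t `^ p).
Proof.
move=> p0 s0 t0.
have st0 : 0 <= Num.max s t by rewrite le_max s0.
apply: (@le_trans _ _ ((2 * Num.max s t) `^ p)).
  apply: ge0_ler_powR; rewrite ?nnegrE ?addr_ge0 ?mulr_ge0//.
  by rewrite mulrC mulr_natr mulr2n lerD// le_max lexx ?orbT.
rewrite powRM// ler_pM2l ?powR_gt0//.
by case: (leP s t) => _; rewrite ?lerDl ?lerDr powR_ge0.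
Qed.

Section MainTheorem.
Context {d : measure_display} {R : realType} {X : metricMeasurableType d R}.
Variables (mu : {measure set X -> \bar R}) (CQC : R) (Omega : set X) (p : R)
  (w : X -> \bar R).
Hypotheses (bmX : borel_set `<=` (measurable : set (set X)))
  (CQC1 : 1 <= CQC) (hQC : quasiconvex X CQC) (p1 : 1 <= p)
  (oO : open Omega) (OT : ~` Omega !=set0) (hw : weight mu Omega w)
  (hwD : semilocally_doubling mu Omega w).

Let bw : borel_fun w. Proof. by case: hw. Qed.
Let w0 y : (0 <= w y)%E. Proof. by case: hw. Qed.

Let d0 x : Omega x -> 0 < dist_to (~` Omega) x.
Proof. exact: dist_to_gt0. Qed.

Let wball (kappa : R) x : 0 < kappa -> Omega x ->
  forall r, 0 < r -> r <= kappa * dist_to (~` Omega) x ->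
     (0 < wmeasure mu w (ball x r) < +oo)%E.
Proof.
move=> kappa0 Ox r r0 rk; have [D _ H] := hwD kappa0.
have [|-> _ _] := H x r Ox; first by rewrite r0.
by case: hw => _ _ -> .
Qed.

Let mball (x : X) (r : R) : measurable (ball x r).
Proof. by apply: bmX; apply: sub_sigma_algebra; exact: open_mball. Qed.

(** The constant comes from [powR_add_le] applied pointwise: the mean of the
    [p]-th power of [g + a] is at most [2 ^ p * (a ^ p + a ^ p) <= (4 a) ^ p]. *)
Lemma maximal_add_cst (kappa : R) (x : X) (g : X -> R) (a : R) :
  0 < kappa -> Omega x -> (forall y, 0 <= g y) -> borel_fun (EFin \o g) ->
  0 <= a -> (maximal mu Omega p w kappa (EFin \o g) x <= a%:E)%E ->
  (maximal mu Omega p w kappa (EFin \o (fun y => g y + a)%R) x <= (4 * a)%:E)%E.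
Proof.
move=> kappa0 Ox g0 bg a0.
have W := wball kappa0 Ox.
have mwX := borel_fun_measurable bmX bw.
have mg := borel_fun_measurable bmX bg.
move=> /(maximal_leP p1 w0 W) H; apply/maximal_leP => //.
  by rewrite mulr_ge0.
move=> r rr; have /andP[r0 rk] := rr; have /andP[Wr0 Wry] := W r r0 (ltW rk).
have Wfin : wmeasure mu w (ball x r) \is a fin_num by rewrite ge0_fin_numE// ltW.
have mwr : measurable_fun (ball x r) w by exact: measurable_funS mwX.
have mgr : measurable_fun (ball x r) (fun y => (`|(EFin \o g) y| `^ p * w y)%E).
  apply: emeasurable_funM => //.
  apply: (measurableT_comp (measurable_poweR p)).
  by apply: measurableT_comp => //; exact: measurable_funS mg.
have {}H := H a0 r rr.
apply: (@le_trans _ _ (\int[mu]_(y in ball x r)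
    ((2 `^ p)%:E * ((`|(EFin \o g) y| `^ p * w y) + (a `^ p)%:E * w y)))%E).
  apply: ge0_le_integral => //.
  - by move=> y _; rewrite mule_ge0// poweR_ge0.
  - apply: emeasurable_funM => //; apply: (measurableT_comp (measurable_poweR p)).
    apply: measurableT_comp => //; apply/measurable_EFinP.
    apply: measurable_funD => //; apply/measurable_EFinP.
    exact: measurable_funS mg.
  - apply: measurable_funeM; apply: emeasurable_funD => //.
    exact: measurable_funeM.
  move=> y _ /=; rewrite -ge0_muleDl ?lee_fin ?powR_ge0//.
  rewrite muleA lee_wpmul2r// -EFinD -EFinM lee_fin.
  by rewrite !ger0_norm ?addr_ge0// powR_add_le// (le_trans _ p1).
rewrite ge0_integralZl//; last 2 first.
- by apply: emeasurable_funD => //; exact: measurable_funeM.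
- by move=> y _; rewrite adde_ge0// mule_ge0// ?poweR_ge0// lee_fin powR_ge0.
rewrite ge0_integralD//; last 3 first.
- by move=> y _; rewrite mule_ge0// poweR_ge0.
- by move=> y _; rewrite mule_ge0// lee_fin powR_ge0.
- exact: measurable_funeM.
rewrite ge0_integralZl// ?lee_fin ?powR_ge0//.
rewrite -/(wmeasure mu w (ball x r)).
apply: (@le_trans _ _ ((2 `^ p)%:E * ((a `^ p)%:E * wmeasure mu w (ball x r)
   + (a `^ p)%:E * wmeasure mu w (ball x r)))%E).
  by rewrite lee_wpmul2l ?lee_fin ?powR_ge0// leeD2r.
have -> : (4 * a) `^ p = 2 `^ p * (2 `^ p * a `^ p).
  by rewrite -!powRM// ?mulr_ge0// mulrA -natrM.
have p2 : 2 <= 2 `^ p :> R by rewrite -[leLHS]powRr1// ler_powR// ler1n.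
rewrite -(fineK Wfin) -!EFinM lee_fin -!mulrA ler_wpM2l ?powR_ge0//.
have : 0 <= a `^ p * fine (wmeasure mu w (ball x r)).
  by rewrite mulr_ge0 ?powR_ge0// fine_ge0// ltW.
by nra.
Qed.

Lemma hardy_weight_of_pointwise :
  pointwise_hardy mu Omega p w -> hardy_weight mu CQC Omega p w.
Proof.
move=> [CH [kappa [CH0 kappa1 hardy]]]; split => //.
have kappa0 : 0 < kappa by rewrite (lt_trans _ kappa1).
(* The curve found below has length at most [(4 CH + 1) dist]; [CQC] is added
   to make [nu] larger than [CQC]. *)
exists (4 * CH + 1), (4 * CH + 1 + CQC), kappa; split => //.
- by lra.
- by lra.
move=> g g0 [M gM] lg x Ox; have dx := d0 Ox.
have W := wball kappa0 Ox.
have bg := borel_fun_lower_semicontinuous lg.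
apply: (le_mul_maximal kappa0 dx); first by rewrite mulr_gt0//; lra.
set dist := dist_to _ _ in dx *.
move=> m a m0 gm ma; have a0 : 0 < a by rewrite (le_lt_trans m0).
have {m m0 ma gm}ga : (maximal mu Omega p w kappa (EFin \o g) x <= a%:E)%E.
  by rewrite (le_trans gm)// lee_fin ltW.
have gaM := maximal_add_cst kappa0 Ox g0 bg (ltW a0) ga.
set h := EFin \o (fun y => g y + a) in gaM.
have bh : borel_fun h.
  rewrite /borel_fun; apply/measurable_EFinP.
  by apply: measurable_funD => //; exact/measurable_EFinP.
have h0 y : (0 <= h y)%E by rewrite lee_fin addr_ge0// ltW.
have hK y : (h y <= (M + a)%:E)%E by rewrite lee_fin lerD2r.
have uL := curve_inf_Lip0 hQC OT bh h0 hK; rewrite setCK in uL.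
have uh := curve_inf_upper_gradient hQC OT bh h0 hK.
have := hardy _ _ uL uh (ex_intro _ _ hK) x Ox.
rewrite ger0_norm ?fine_ge0 ?curve_inf_ge0//.
have Ifin := curve_inf_fin_num hQC OT bh h0 hK x.
rewrite fineK// => H.
have {}H : (curve_inf (~` Omega) h x <= (CH * dist * (4 * a))%:E)%E.
  apply: (le_trans H); rewrite [leRHS]EFinM lee_wpmul2l// lee_fin mulr_ge0// ltW//.
(* The slack [a * dist] in the infimum has the same size as the bound on it. *)
have ad0 : 0 < a * dist by rewrite mulr_gt0.
have [_ [gamma [gs ge] <-] Hg] := lb_ereal_inf_adherent ad0 Ifin.
have {H Hg} Hg : (curve_integral h gamma < ((4 * CH + 1) * dist * a)%:E)%E.
  apply: (lt_le_trans Hg); rewrite -/(curve_inf _ _ _).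
  rewrite (_ : _ * a = CH * dist * (4 * a) + a * dist); last by ring.
  by rewrite EFinD leeD2r.
apply: (@le_trans _ _ (curve_integral h gamma)); last exact: ltW.
apply: (@le_trans _ _ (curve_integral (EFin \o g) gamma)); last first.
  by apply: ge0_le_curve_integral => // y; rewrite lee_fin lerDl ltW.
apply: ereal_inf_lbound; exists gamma => //; split => //.
have ah y : (a%:E <= h y)%E by rewrite lee_fin lerDr.
have := le_lt_trans (curve_integral_ge gamma bh (ltW a0) ah) Hg.
rewrite -(fineK (len_fin_num gamma)) -EFinM lte_fin mulrC ltr_pM2r// lee_fin.
move=> /ltW /le_trans; apply; rewrite -/dist ler_pM2r//.
by have := CQC1; lra.
Qed.

Lemma pointwise_of_hardy_weight :
  hardy_weight mu CQC Omega p w -> pointwise_hardy mu Omega p w.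
Proof.
move=> [_ [CG [nu [kappa [CG0 nuC kappa1 hardy]]]]].
have kappa0 : 0 < kappa by rewrite (lt_trans _ kappa1).
have p0 : 0 < p by rewrite (lt_le_trans _ p1).
exists CG, kappa; split => // u g [_ u0] [bg g0 ug] [M gM] x Ox.
have dx := d0 Ox; have W := wball kappa0 Ox.
apply: (le_mul_maximal kappa0 dx); first by rewrite mulr_gt0.
set dist := dist_to _ _ in dx *.
move=> m a m0 gm ma; have a0 : 0 < a by rewrite (le_lt_trans m0).
have gfin y : g y \is a fin_num.
  by rewrite ge0_fin_numE// (le_lt_trans (gM y)) ?ltry.
have gfine y : g y = (fine (g y))%:E by rewrite fineK.
pose f y := fine (g y) `^ p.
have fE y : (`|g y| `^ p)%E = (f y)%:E.
  by rewrite /f {1}gfine/= ger0_norm ?fine_ge0// poweR_EFin.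
have M0 : 0 <= M by rewrite -lee_fin (le_trans (g0 x)).
have e0 : 0 < a `^ p - m `^ p.
  by rewrite subr_gt0; apply: gt0_ltr_powR; rewrite ?nnegrE// ltW.
have rho0 : 0 < kappa * dist by rewrite mulr_gt0.
have [|||y|f' [f'0 [K f'K] f'lsc ff' f'int]] :=
  @lsc_majorant_off_point _ _ _ mu w x (kappa * dist) (M `^ p) _ f
    bmX bw w0 rho0 _ _ _ _ e0.
- by have /andP[] := W _ rho0 (lexx _).
- by move=> r r0 rr; have /andP[] := W r r0 rr.
- rewrite (_ : EFin \o f = (fun y => `|g y| `^ p)%E); last first.
    by apply/funext => y; rewrite fE.
  apply: (measurableT_comp (measurable_poweR p)).
  exact: measurableT_comp.
- rewrite powR_ge0/=; apply: ge0_ler_powR; rewrite ?nnegrE ?fine_ge0// ?(ltW p0)//.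
  by rewrite -lee_fin -gfine.
(* [f'] majorizes the [p]-th power of [g] off [x]; as the root is increasing,
   [h] inherits both the majorization and the lower semicontinuity. *)
pose h y := f' y `^ p^-1.
have pV0 : 0 <= p^-1 by rewrite invr_ge0 ltW.
have h0 y : 0 <= h y by exact: powR_ge0.
have hK : exists K, forall y, h y <= K.
  exists (K `^ p^-1) => y; apply: ge0_ler_powR; rewrite ?nnegrE//.
  exact: le_trans (f'0 y) (f'K y).
have hlsc : lower_semicontinuous (EFin \o h).
  move=> y b; rewrite lte_fin => bh; exists [set z | f' y <= f' z].
    exact: f'lsc.
  move=> z /= yz; rewrite lte_fin (lt_le_trans bh)//.
  by apply: ge0_ler_powR; rewrite ?nnegrE.
have hm : (maximal mu Omega p w kappa (EFin \o h) x <= a%:E)%E.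
  apply/maximal_leP => //; first exact: ltW.
  move=> r rr; have /andP[r0 rk] := rr.
  have hE y : (`|(EFin \o h) y| `^ p)%E = (f' y)%:E.
    rewrite /= ger0_norm// /h -powRrM mulVf ?gt_eqF//.
    by rewrite powRr1.
  under eq_integral do rewrite hE.
  apply: (le_trans (f'int r r0 (ltW rk))).
  have := (maximal_leP p1 w0 W g m0).1 gm r rr.
  under eq_integral do rewrite fE.
  move=> H; apply: (le_trans (leeD2r _ H)).
  have /andP[W0 Wy] := W r r0 (ltW rk).
  rewrite -(fineK (_ : wmeasure mu w (ball x r) \is a fin_num)).
    by rewrite -!EFinM -EFinD lee_fin; lra.
  by rewrite ge0_fin_numE// ltW.
apply: (@le_trans _ _ ((CG * dist)%:E * maximal mu Omega p w kappa (EFin \o h) x)%E);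
  last by rewrite [leRHS]EFinM lee_wpmul2l// lee_fin mulr_ge0// ltW.
apply: le_trans (hardy h h0 hK hlsc x Ox).
apply: le_ereal_inf_tmp => _ [gamma [gs ge _] <-].
have [gamma' [gs' ge' gi']] := tail_curve gamma.
have := ug gamma'; rewrite gs' ge' gs (u0 _ ge) subr0 => /le_trans; apply.
apply: gi' => //.
- exact: borel_fun_lower_semicontinuous.
- move=> y; rewrite gs => /ff' fy; rewrite gfine lee_fin.
  rewrite -[leLHS](_ : f y `^ p^-1 = _); last first.
    by rewrite /f -powRrM mulfV ?gt_eqF// powRr1// fine_ge0.
  by apply: ge0_ler_powR; rewrite ?nnegrE ?powR_ge0.
Qed.

End MainTheorem.

Unset Implicit Arguments.

Theorem lemma7p2 (d : measure_display) (R : realType)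
    (X : metricMeasurableType d R) (mu : {measure set X -> \bar R})
    (hX : metric_measure_space mu)
    (CQC : R) (hCQC : 1 <= CQC) (hQC : quasiconvex X CQC)
    (p : R) (hp : 1 <= p)
    (Omega : set X) (hOmega : open Omega) (hOmega0 : Omega !=set0)
    (hOmegaT : Omega `<` setT)
    (w : X -> \bar R) (hw : weight mu Omega w)
    (hwD : semilocally_doubling mu Omega w) :
  pointwise_hardy mu Omega p w <-> hardy_weight mu CQC Omega p w.
Proof.
have [_ _ [bmX _] _] := hX.
have OT : ~` Omega !=set0.
  move: hOmegaT; rewrite properEneq => -[OT _].
  by apply/set0P/eqP => O0; move/eqP: OT; apply; rewrite -(setCK Omega) O0 setC0.
split; first exact: hardy_weight_of_pointwise.
exact: pointwise_of_hardy_weight.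
Qed.
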